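(* Let $G$ be a finitely generated infinite amenable group with a finite symmetric generating set $S$. Then there exists a sequence of multi-tiles $(T_n)_{n\in\mathbb{N}}$ of $G$, where $T_n=(T_{1n},\dots,T_{Nn})$ and $N=N(n)$, such that $|T_{in}|\le n$ for each $1\le i\le N(n)$ and $$\max_{1\le i\le N(n)}\frac{|\partial T_{in}|}{|T_{in}|}\longrightarrow 0\quad\text{as } n\to\infty.$$ For every such multi-tile $T_n$ and any free probability measure preserving action $G\curvearrowright (X,\mu)$ on a standard probability measure space, we have $$\mathcal{I}_{(G,S)\curvearrowright X}(n)\le \max_{1\le i\le N(n)}\frac{|\partial T_{in}|}{|T_{in}|}.$$ In particular, if $\max_{1\le i\le N(n)}\frac{|\partial T_{in}|}{|T_{in}|}$ is asymptotic to $\mathcal{I}_G(n)$, then $\mathcal{I}_{(G,S)\curvearrowright X}(n)$ is asymptotic to $\mathcal{I}_G(n)$.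
   Context: A generating set $S$ of $G$ is symmetric if $s\in S$ implies $s^{-1}\in S$. For finite $F\subset G$, $\partial F=\{g\in F: sg\notin F\text{ for some } s\in S\}$, and the isoperimetric profile of $G$ (with respect to $S$) is $\mathcal{I}_G(n)=\inf\{|\partial F|/|F| : F\subset G,\ 1\le |F|\le n\}$. A multi-tile of $G$ is a finite collection $(F_1,\dots,F_m)$ of finite subsets of $G$ with $e\in F_i$ for each $i$, such that there exist subsets $C_1,\dots,C_m\subset G$ (center sets) for which the sets $F_ic$ ($1\le i\le m$, $c\in C_i$) partition $G$. Let $\mathcal{R}\subset X\times X$ be the orbit equivalence relation of the action. A subequivalence relation of $\mathcal{R}$ is a subset of $\mathcal{R}$ that is itself an equivalence relation on $X$; all subequivalence relations are assumed measurable as subsets of $X\times X$. For such $\theta\subset\mathcal{R}$, $[x]_\theta$ is the class of $x$, $|\theta|$ is the maximal size of an equivalence class of $\theta$, and $$\partial\theta=\{x\in X : sx\notin [x]_\theta \text{ for some } s\in S\}.$$ The isoperimetric profile of the action is $$\mathcal{I}_{(G,S)\curvearrowright X}(n)=\inf\{\mu(\partial\theta) : \theta\subset\mathcal{R}\text{ a measurable subequivalence relation with } |\theta|\le n\}.$$ Two positive functions $a(n),b(n)$ are asymptotic if $a(n)/b(n)\to 1$ as $n\to\infty$. *)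

(* Defs.v *)
From HB Require Import structures.
From mathcomp Require Import all_boot all_order all_algebra finmap.
From mathcomp Require Import all_classical all_reals all_analysis.

Set Implicit Arguments.
Unset Strict Implicit.
Unset Printing Implicit Defensive.

Import Order.TTheory GRing.Theory Num.Theory.
Import numFieldNormedType.Exports.

Local Open Scope classical_set_scope.
Local Open Scope ring_scope.

Section Group.
Context {R : realType} {G : groupType}.
Implicit Types (S F : {fset G}) (H : set G).

Definition symmetric_fset S := forall s, s \in S -> (s^-1)%g \in S.

Definition is_subgroup H :=
  [/\ H 1%g, forall x y, H x -> H y -> H (x * y)%g & forall x, H x -> H (x^-1)%g].

Definition generates S :=
  forall H, is_subgroup H -> [set` S] `<=` H -> H = [set: G].

Definition ltranslate (k : G) F : {fset G} := [fset (k * g)%g | g in F]%fset.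

(* Left Folner condition: left translates match the boundary below, which is
   defined with left multiplication and is invariant under right translation. *)
Definition amenable_group :=
  forall (K : {fset G}) (e : R), 0 < e ->
    exists F, F != fset0 /\ forall k, k \in K ->
      #|` ((ltranslate k F `\` F) `|` (F `\` ltranslate k F))%fset|%:R <= e * #|` F|%:R.

Definition boundary S F : {fset G} :=
  [fset g in F | has (fun s => (s * g)%g \notin F) S]%fset.

Definition boundary_ratio S F : R := #|` boundary S F|%:R / #|` F|%:R.

Definition group_profile S (n : nat) : R :=
  inf [set boundary_ratio S F | F in [set F | (1 <= #|` F| <= n)%N]].

Definition rtranslate F (c : G) : set G := [set (g * c)%g | g in [set` F]].

(* The translates are indexed by the pairs (i, c) with c \in C i, so no two
   of them overlap, including those coming from different shapes F i. *)
Definition multi_tile (m : nat) (F : 'I_m -> {fset G}) :=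
  (forall i, 1%g \in F i) /\
  exists C : 'I_m -> set G,
    partition [set ic : 'I_m * G | C ic.1 ic.2]
              (fun ic => rtranslate (F ic.1) ic.2) [set: G].

(* The default value 0 is harmless: ratios are nonnegative and a multi-tile
   has at least one shape. *)
Definition max_ratio S (m : nat) (F : 'I_m -> {fset G}) : R :=
  \big[Num.max/0]_(i < m) boundary_ratio S (F i).

(* The size bound |T_in| <= n cannot hold at n = 0, as shapes are nonempty;
   T 0 is left unconstrained. *)
Definition folner_multi_tiles S (N : nat -> nat)
    (T : forall n, 'I_(N n) -> {fset G}) :=
  (forall n, (0 < n)%N ->
     multi_tile (T n) /\ forall i, (#|` T n i| <= n)%N) /\
  max_ratio S (T n) @[n --> \oo] --> (0 : R).

End Group.

Arguments amenable_group R G : clear implicits.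
Arguments group_profile R {G} S n.
Arguments max_ratio R {G} S {m} F.
Arguments folner_multi_tiles R {G} S N T.

Definition asymptotic (R : realType) (a b : nat -> R) :=
  a n / b n @[n --> \oo] --> (1 : R).

(* X is Borel isomorphic to a Polish space; hausdorff_space turns the complete
   pseudometric into a metric, and second countability is separability. *)
Definition standard_borel (R : realType) d (X : measurableType d) :=
  exists (Y : completePseudoMetricType R) (f : X -> Y),
    [/\ hausdorff_space Y, @second_countable Y, bijective f &
        forall A : set X, measurable A <-> <<s @open Y >> (f @` A)].

Section Action.
Context {R : realType} {G : groupType} {d : measure_display}
  {X : measurableType d}.
Implicit Types (mu : probability X R) (a : G -> X -> X) (S : {fset G})
  (theta : set (X * X)).

Definition pmp_action mu a :=
  [/\ forall x, a 1%g x = x,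
      forall g h x, a (g * h)%g x = a g (a h x),
      forall g, measurable_fun [set: X] (a g) &
      forall g A, measurable A -> mu (a g @^-1` A) = mu A].

Definition free_action mu a :=
  {ae mu, forall x, forall g, a g x = x -> g = 1%g}.

Definition orbit_rel a : set (X * X) := [set xy | exists g, a g xy.1 = xy.2].

Definition sub_equiv_rel a theta :=
  [/\ measurable theta,
      theta `<=` orbit_rel a,
      forall x, theta (x, x),
      forall x y, theta (x, y) -> theta (y, x) &
      forall x y z, theta (x, y) -> theta (y, z) -> theta (x, z)].

(* The class of x under theta is xsection theta x. *)
Definition class_size_le theta (n : nat) :=
  forall x, (xsection theta x #<= `I_n)%card.

Definition rel_boundary S a theta : set X :=
  [set x | exists2 s, s \in S & ~ xsection theta x (a s x)].

Definition action_profile S mu a (n : nat) : R :=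
  inf [set fine (mu (rel_boundary S a theta)) | theta in
         [set theta | sub_equiv_rel a theta /\ class_size_le theta n]].

End Action.

(* Main.v *)
(** A single Foelner set F suffices. Run through countably many translates F x,
   and whenever at least a fixed proportion of F x has not been used yet, make the
   unused part of F x a tile. The unused set that remains has small upper density.
   A point lies near the boundary of its tile only if it, or a neighbour of it,
   sits in the boundary of the translate that produced its own tile; since F is
   almost invariant such points are rare on average, whatever the order.

   In G itself, tiles with a large boundary are dissolved; they and the unused
   points have small density and are redistributed injectively, with bounded
   displacement, over the remaining tiles by Hall's theorem. This perturbs every
   tile by a small proportion only and gives exact Foelner tilings.

   In a free action, the same greedy tower covers X up to a small error, and each
   tile is cut into the pieces of a multi-tile of G, which bounds the profile of
   the action from above. Conversely every class of a subrelation is a translate of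
   a finite F in G; counting boundary points per class and using invariance of the
   measure gives the lower bound by the profile of G. *)

Require Import Defs.
From HB Require Import structures.
From mathcomp Require Import all_boot all_order all_algebra finmap.
From mathcomp Require Import all_classical all_reals all_analysis.
From mathcomp Require Import measurable_realfun zify.

Set Implicit Arguments.
Unset Strict Implicit.
Unset Printing Implicit Defensive.

Import Order.TTheory GRing.Theory Num.Theory.
Import numFieldNormedType.Exports.

Local Open Scope classical_set_scope.
Local Open Scope ring_scope.

(** * Finite sets in groups *)

(** The threshold [t] answers two opposite demands. It must also be large against the boundary of F,
    because a tile has at least [t] points and at most that many edge points. Almost invariance
    leaves room for both, so one shape does the work of a hierarchy of shapes. Neither demand
    involves the order of the stages, so the argument runs in any action in which the translates
    removed together are disjoint: trivial in G with one centre per stage, and a consequence of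
    freeness and a countable separating family in X. Defects are repaired differently in the two
    uses. In G no tile size is prescribed, so tiles may grow to absorb them. In X the class size n
    is prescribed and nothing may be added to a class, but defects cost only their measure: leftover
    points and cells cut by the end of a tile simply become singletons. *)

Lemma fsubset_card (T : choiceType) (A B : {fset T}) :
  (forall x, x \in A -> x \in B) -> (#|` A| <= #|` B|)%N.
Proof. by move=> AB; apply/fsubset_leq_card/fsubsetP. Qed.

Lemma leq_card_inj (T U : choiceType) (f : T -> U) (A : {fset T}) (B : {fset U}) :
  {in A &, injective f} -> (forall x, x \in A -> f x \in B) -> (#|` A| <= #|` B|)%N.
Proof.
move=> /(card_in_imfset imfset_key) /= <- fAB.
by apply: fsubset_card => y /imfsetP[x /= /fAB ? ->].
Qed.

Lemma card_bigfcup_le (I : Type) (T : choiceType) (r : seq I) (F : I -> {fset T})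
    (c : nat) : (forall i, #|` F i| <= c)%N ->
  (#|` \bigcup_(i <- r) F i|%fset <= size r * c)%N.
Proof.
move=> Fc; elim: r => [|i r IH]; first by rewrite big_nil.
rewrite big_cons mulSn; apply: leq_trans (leq_add (Fc i) IH).
exact: leq_card_fsetU.
Qed.

Lemma in_fset_filter (T : choiceType) (A : {fset T}) (p : pred T) x :
  (x \in [fset y in A | p y]%fset) = (x \in A) && p x.
Proof. by rewrite !inE. Qed.

Lemma card_fset_filter (T : choiceType) (A : {fset T}) (p : pred T) :
  #|` [fset x in A | p x]%fset| = (\sum_(x <- A) p x)%N.
Proof.
rewrite card_fset_sum1 big_fset /= big_mkcond /=.
by apply: eq_bigr => x _; case: (p x).
Qed.

Lemma double_count (T U : choiceType) (A : {fset T}) (B : {fset U})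
    (r : T -> U -> bool) :
  (\sum_(x <- A) #|` [fset y in B | r x y]%fset| =
   \sum_(y <- B) #|` [fset x in A | r x y]%fset|)%N.
Proof.
under eq_bigr do rewrite card_fset_filter.
by rewrite exchange_big; apply: eq_bigr => y _; rewrite card_fset_filter.
Qed.

Section Products.
Context {G : groupType}.
Implicit Types (A B F K S : {fset G}) (g h c : G).

Definition fmul A B : {fset G} :=
  (\bigcup_(x <- A) [fset (x * y)%g | y in B])%fset.
Definition finv A : {fset G} := [fset (x^-1)%g | x in A]%fset.

Lemma fmulP A B g :
  reflect (exists x y, [/\ x \in A, y \in B & g = (x * y)%g]) (g \in fmul A B).
Proof.
apply: (iffP (bigfcupP _ _ _ _)) => [[x]|[x [y [xA yB ->]]]].
  by rewrite andbT => xA /imfsetP[y /= yB ->]; exists x, y.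
by exists x; rewrite ?xA // in_imfset.
Qed.

Lemma mem_fmul A B x y : x \in A -> y \in B -> (x * y)%g \in fmul A B.
Proof. by move=> xA yB; apply/fmulP; exists x, y. Qed.

Lemma mem_finv A x : ((x^-1)%g \in finv A) = (x \in A).
Proof. by rewrite mem_imfset //; apply: invg_inj. Qed.

Lemma finvE A x : (x \in finv A) = ((x^-1)%g \in A).
Proof. by rewrite -{1}(invgK x) mem_finv. Qed.

Lemma card_rmul A c : #|` [fset (g * c)%g | g in A]%fset| = #|` A|.
Proof. by rewrite card_imfset //; apply: mulIg. Qed.

Lemma card_lmul A c : #|` [fset (c * g)%g | g in A]%fset| = #|` A|.
Proof. by rewrite card_imfset //; apply: mulgI. Qed.

Lemma card_fmul_le A B : (#|` fmul A B| <= #|` A| * #|` B|)%N.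
Proof. by apply: card_bigfcup_le => x; apply: leq_imfset_card. Qed.

Lemma mem_rmul A c x : (x \in [fset (g * c)%g | g in A]%fset) = ((x * c^-1)%g \in A).
Proof.
apply/imfsetP/idP => [[g /= gA ->]|xA]; first by rewrite mulgK.
by exists (x * c^-1)%g => //; rewrite mulgVK.
Qed.

Lemma mem_lmul A c x : (x \in [fset (c * g)%g | g in A]%fset) = ((c^-1 * x)%g \in A).
Proof.
apply/imfsetP/idP => [[g /= gA ->]|xA]; first by rewrite mulKg.
by exists (c^-1 * x)%g => //; rewrite mulVKg.
Qed.

Lemma boundaryP S F g :
  reflect (g \in F /\ exists2 s, s \in S & (s * g)%g \notin F) (g \in boundary S F).
Proof.
rewrite !inE /=; apply: (iffP andP) => -[gF]; first by move=> /hasP[s]; split; last exists s.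
by move=> [s sS sF]; split=> //; apply/hasP; exists s.
Qed.

Lemma boundary_rmul S F c :
  boundary S [fset (g * c)%g | g in F]%fset = [fset (g * c)%g | g in boundary S F]%fset.
Proof.
apply/fsetP => x; rewrite mem_rmul; apply/boundaryP/boundaryP.
  rewrite mem_rmul => -[xF [s sS]]; rewrite mem_rmul => sx; split=> //.
  by exists s => //; rewrite mulgA.
by move=> [xF [s sS sx]]; rewrite mem_rmul; split=> //; exists s; rewrite ?mem_rmul -?mulgA.
Qed.

Lemma boundary_ratio_rmul (R : realType) S F c :
  boundary_ratio S [fset (g * c)%g | g in F]%fset = boundary_ratio S F :> R.
Proof. by rewrite /boundary_ratio boundary_rmul !card_rmul. Qed.

Lemma card_boundary_le S F : (#|` boundary S F| <= #|` F|)%N.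
Proof. by apply: fsubset_card => z /boundaryP[]. Qed.

Lemma card_boundary_sum K F :
  (#|` boundary K F| <= \sum_(k <- K) #|` [fset g in F | (k * g)%g \notin F]%fset|)%N.
Proof.
rewrite double_count card_fset_filter leq_sum // => g _.
case: hasP => [[k kK kg]|//] /=.
by rewrite cardfs_gt0; apply/fset0Pn; exists k; rewrite !inE kK.
Qed.

Section Amenable.
Variables (R : realType) (G_amen : amenable_group R G).

Lemma folner_boundary K (N : nat) :
  exists2 F, F != fset0 & (N * #|` boundary K F| <= #|` F|)%N.
Proof.
pose e : R := (N * #|` K|).+1%:R^-1.
have e0 : 0 < e by rewrite invr_gt0 ltr0n.
have [F [F0 Fe]] := G_amen K e0; exists F => //.
have kF k : k \in K ->
    ((N * #|` K|).+1 * #|` [fset g in F | (k * g)%g \notin F]%fset| <= #|` F|)%N.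
  move=> /Fe; rewrite -(ler_nat R) natrM -ler_pdivlMl ?ltr0n //.
  apply: le_trans; rewrite ler_nat.
  rewrite -(card_lmul _ k).
  apply: fsubset_card => z /imfsetP[g /=]; rewrite !inE /= => /andP[gF kg] ->.
  by rewrite kg mem_lmul mulKg gF.
apply: leq_trans (leq_mul (leqnn N) (card_boundary_sum K F)) _.
rewrite big_distrr /=.
have [/eqP|K0] := posnP #|` K|.
  by rewrite cardfs_eq0 => /eqP ->; rewrite big_seq_fset0.
rewrite -(leq_pmul2l K0) big_distrr /=.
apply: (@leq_trans (\sum_(k <- K) #|` F|)%N); last first.
  by rewrite big_const_seq count_predT iter_addn_0 mulnC.
rewrite big_seq [leqRHS]big_seq leq_sum // => k /kF; apply: leq_trans.
by rewrite mulnA leq_mul2r mulnC leqnSn orbT.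
Qed.

(** A point of [K F] outside [F] is [k g] with [g] on the [K]-boundary of [F], so a boundary smaller
    than [F] by the factor [#|K|] is enough. A doubling bound suffices for comparing densities up to
    a constant. *)
Lemma folner_product K : exists2 F, F != fset0 & (#|` fmul K F| <= 2 * #|` F|)%N.
Proof.
have [F F0 KF] := folner_boundary K #|` K|; exists F => //.
rewrite mul2n -addnn.
apply: (@leq_trans #|` F `|` fmul K (boundary K F)|%fset).
  apply: fsubset_card => z /fmulP[k [g [kK gF ->]]]; rewrite inE.
  have [//|kg] /= := boolP ((k * g)%g \in F).
  by apply: mem_fmul => //; apply/boundaryP; split=> //; exists k.
apply: leq_trans (leq_card_fsetU _ _) _; rewrite leq_add2l.
exact: leq_trans (card_fmul_le _ _) KF.
Qed.

End Amenable.
End Products.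

(** * Infinite Hall matchings *)

Section Hall.
Context {T U : choiceType}.
Variable Z : set T.
Implicit Types (N M : T -> {fset U}) (P : {fset T}).

Definition nbhd N P : {fset U} := (\bigcup_(z <- P) N z)%fset.

Definition hall_condition N :=
  forall P, [set` P] `<=` Z -> (#|` P| <= #|` nbhd N P|)%N.

Lemma nbhdP N P u : reflect (exists2 z, z \in P & u \in N z) (u \in nbhd N P).
Proof.
apply: (iffP (bigfcupP _ _ _ _)) => -[z zP uz]; exists z => //.
  by move: zP; rewrite andbT.
by rewrite zP.
Qed.

Lemma eq_nbhd N M P : (forall z, z \in P -> N z = M z) -> nbhd N P = nbhd M P.
Proof. by move=> NM; apply: eq_big_seq => z /NM. Qed.

(** Zorn for reverse inclusion. A chain is bounded by its pointwise intersection, which keeps Hall's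
    condition because neighbourhoods are finite: on a finite [P], the member with the fewest edges
    at [P] already agrees with the intersection. *)
Lemma hall_minimal N : hall_condition N ->
  exists2 M, hall_condition M /\ (forall z, M z `<=` N z)%fset &
    forall M', hall_condition M' -> (forall z, M' z `<=` M z)%fset -> M' = M.
Proof.
move=> hN.
pose W := {M | hall_condition M /\ (forall z, M z `<=` N z)%fset}.
pose r (M M' : W) := `[< forall z, (sval M' z `<=` sval M z)%fset >].
have valI (M M' : W) : sval M = sval M' -> M = M'.
  by case: M M' => [M hM] [M' hM'] /= MM'; move: hM'; rewrite -MM' => hM'; congr exist.
have [||||[M [hM MN]] Mmax] := @Zorn W r.
- by move=> M; apply/asboolP.
- move=> M1 M2 M3 /asboolP h12 /asboolP h23; apply/asboolP => z.
  exact: fsubset_trans (h23 z) (h12 z).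
- move=> M1 M2 /asboolP h12 /asboolP h21; apply: valI; apply/funext => z.
  by apply/eqP; rewrite eqEfsubset h12 h21.
- move=> A Atot.
  have [[M0 AM0]|A0] := pselect (exists M : W, A M); last first.
    by exists (exist _ N (conj hN (fun z => fsubset_refl (N z)))) => M AM; case: A0; exists M.
  pose L z := [fset u in sval M0 z | `[< forall M : W, A M -> u \in sval M z >]]%fset.
  have LM (M : W) z : A M -> (L z `<=` sval M z)%fset.
    by move=> AM; apply/fsubsetP => u; rewrite !inE /= => /andP[_ /asboolP]; apply.
  have hL : hall_condition L /\ (forall z, L z `<=` N z)%fset.
    split=> [P PZ|z]; last by apply: fsubset_trans (LM _ _ AM0) _; exact: (svalP M0).2.
    pose w (M : W) := (\sum_(z <- P) #|` sval M z|)%N.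
    have exw : exists n, `[< exists2 M : W, A M & w M = n >] by exists (w M0); apply/asboolP;
        exists M0.
    case: (ex_minnP exw) => n /asboolP[M AM wM] nmin.
    rewrite (@eq_nbhd L (sval M)) => [|z zP]; first exact: (svalP M).1.
    apply/eqP; rewrite eqEfsubset LM //=; apply/fsubsetP => u uM.
    suff uA (M' : W) : A M' -> u \in sval M' z by rewrite !inE /= uA //; apply/asboolP.
    move=> AM'; have [/asboolP MM'|/asboolP/(_ z)/fsubsetP] := Atot _ _ AM AM'; last exact.
    have le_nw : (w M <= w M')%N by rewrite wM; apply: nmin; apply/asboolP; exists M'.
    have : (w M' < w M)%N || (sval M' z == sval M z).
      rewrite -implyNb; apply/implyP; rewrite -leqNgt => _.
      rewrite eqEfcard MM' /=; move: le_nw; rewrite /w !(big_fsetD1 z zP) /= => le_nw.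
      rewrite -(leq_add2r (\sum_(y <- (P `\ z)%fset) #|` sval M y|)%N).
      apply: leq_trans le_nw _; rewrite leq_add2l leq_sum // => y _.
      exact/fsubset_leq_card.
    by rewrite ltnNge le_nw /= => /eqP ->.
  by exists (exist _ L hL) => M AM; apply/asboolP => z /=; exact: LM.
exists M => // M' hM' M'M.
have hM'' : hall_condition M' /\ (forall z, M' z `<=` N z)%fset.
  by split=> // z; exact: fsubset_trans (M'M z) (MN z).
have /= := Mmax (exist _ M' hM''); move=> /(_ _)/(congr1 sval) /=; apply.
exact/asboolP.
Qed.

(* Rado: if deleting either of two elements of [M z] breaks Hall's condition,
   the two violating sets contradict the submodularity of [#|` nbhd M _|]. *)
Lemma hall_minimal_unique M : hall_condition M ->
  (forall M', hall_condition M' -> (forall z, M' z `<=` M z)%fset -> M' = M) ->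
  forall z, Z z -> forall a b, a \in M z -> b \in M z -> a = b.
Proof.
move=> hM Mmin z Zz.
have del c : c \in M z -> exists P, [/\ [set` P] `<=` Z, z \notin P &
    (#|` nbhd M P `|` (M z `\ c)|%fset <= #|` P|)%N].
  move=> cz; pose M' y := if y == z then (M z `\ c)%fset else M y.
  have M'M y : (M' y `<=` M y)%fset.
    by rewrite /M'; case: eqP => [->|_]; rewrite ?fsubset_refl // fsubsetDl.
  have [/Mmin/(_ M'M)/(congr1 (fun f => c \in f z))|/existsNP[P]] := pselect (hall_condition M').
    by rewrite /M' eqxx cz !inE eqxx.
  move=> /not_implyP[PZ /negP]; rewrite -ltnNge => Plt.
  have [zP|zP] := boolP (z \in P); last first.
    move: Plt; rewrite (@eq_nbhd M' M); first by rewrite ltnNge hM.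
    by move=> y yP; rewrite /M'; case: eqP => // yz; move: zP; rewrite -yz yP.
  exists (P `\ z)%fset; split; first by move=> y /=; rewrite !inE => /andP[_ /PZ].
    by rewrite !inE eqxx.
  rewrite -ltnS -[X in (_ < X)%N]/(1 + _)%N (_ : 1 + _ = #|` P|)%N; last first.
    by rewrite (cardfsD1 z P) zP.
  apply: leq_ltn_trans Plt; apply: fsubset_card => u; rewrite inE => /orP[|uz].
    move=> /nbhdP[y]; rewrite !inE => /andP[yz yP] uy; apply/nbhdP; exists y => //.
    by rewrite /M' (negbTE yz).
  by apply/nbhdP; exists z => //; rewrite /M' eqxx.
move=> a b az bz; apply/eqP/negPn/negP => ab.
have [P1 [P1Z zP1 h1]] := del a az; have [P2 [P2Z zP2 h2]] := del b bz.
have hU : (#|` z |` (P1 `|` P2)|%fset <= #|` (nbhd M P1 `|` (M z `\ a)) `|` (nbhd M P2 `|` (M z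
    `\ b))|%fset)%N.
  apply: leq_trans (hM _ _) _.
    by move=> y /=; rewrite !inE => /orP[/eqP ->//|/orP[/P1Z|/P2Z]].
  apply: fsubset_card => u /nbhdP[y]; rewrite !inE => /orP[/eqP -> uz|/orP[yP|yP] uy].
  - by rewrite uz !andbT; case: (eqVneq u a) => [->|_]; rewrite ?ab ?orbT.
  - by rewrite (_ : u \in nbhd M P1) //; apply/nbhdP; exists y.
  - by rewrite (_ : u \in nbhd M P2) ?orbT //; apply/nbhdP; exists y.
have hI : (#|` P1 `&` P2|%fset <= #|` (nbhd M P1 `|` (M z `\ a)) `&` (nbhd M P2 `|` (M z `\
    b))|%fset)%N.
  apply: leq_trans (hM _ _) _; first by move=> y /=; rewrite inE => /andP[/P1Z].
  apply: fsubset_card => u /nbhdP[y]; rewrite !inE => /andP[yP1 yP2] uy.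
  by apply/andP; split; apply/orP; left; apply/nbhdP; exists y.
move: (leq_add hU hI) (leq_add h1 h2).
rewrite cardfsU1 inE (negbTE zP1) (negbTE zP2) /= -addnA !cardfsUI.
by move=> /leq_trans /[apply]; rewrite add1n ltnn.
Qed.

(** In a minimal system each [M z] is a singleton: nonempty by Hall's condition on one point, with
    no second element by minimality. Hall's condition on two points then gives injectivity. *)
Theorem hall_matching (u0 : U) N : hall_condition N ->
  exists2 f : T -> U, (forall z, Z z -> f z \in N z) &
    (forall z w, Z z -> Z w -> f z = f w -> z = w).
Proof.
move=> /hall_minimal[M [hM MN] /(hall_minimal_unique hM) Muniq].
pose f z := head u0 (M z).
have fM z : Z z -> f z \in M z.
  move=> Zz; have /hM : [set` [fset z]%fset] `<=` Z.
    by move=> y; rewrite /= inE => /eqP ->.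
  rewrite cardfs1 /nbhd big_seq_fset1 /f -[_ \in M z]/(_ \in enum_fset (M z)).
  by case: (enum_fset (M z)) => [|u s] //= _; rewrite inE eqxx.
exists f => [z Zz|z w Zz Zw fzw]; first by apply/(fsubsetP (MN z))/fM.
apply/eqP/negPn/negP => zw.
have /hM : [set` [fset z; w]%fset] `<=` Z.
  by move=> y; rewrite /= !inE => /orP[]/eqP ->.
rewrite cardfs2 zw; suff /fsubset_card : forall u, u \in nbhd M [fset z;
    w]%fset -> u \in [fset f z]%fset.
  by rewrite cardfs1 => h /leq_trans -/(_ _ h).
move=> u /nbhdP[y].
rewrite !inE => /orP[]/eqP -> uM; apply/eqP; first exact: Muniq Zz _ _ uM (fM z Zz).
by rewrite fzw; exact: Muniq Zw _ _ uM (fM w Zw).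
Qed.
End Hall.

(** * Partitions into cells *)

Lemma fset_head_mem (T : choiceType) (A : {fset T}) x : x \in A -> head x A \in A.
Proof.
have memE y : (y \in A) = (y \in enum_fset A) by [].
by rewrite !memE; case: (enum_fset A) => [|y s] // _; exact: mem_head.
Qed.

Lemma fset_head_eq (T : choiceType) (A : {fset T}) x y z :
  z \in A -> head x A = head y A.
Proof. by rewrite -[z \in A]/(z \in enum_fset A); case: (enum_fset A). Qed.

Section Cells.
Context {G : groupType}.
Implicit Types (S F U W : {fset G}) (cell : G -> {fset G}) (g h c : G).

(** A partition is held as a map from points to classes, so no centres have to be chosen and kept
    consistent while tiles are enlarged. *)
Definition cell_partition cell :=
  (forall g, g \in cell g) /\ (forall g h, h \in cell g -> cell h = cell g).

(** Removing one cell at a time adds up the cellwise inequalities: a proportion checked inside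
    single tiles becomes a density over a large finite set. *)
Lemma saturated_count (R : numDomainType) cell U (Q Q' : pred G) (a b : R) :
  cell_partition cell ->
  (forall g, g \in U -> (cell g `<=` U)%fset) ->
  (forall g, g \in U -> a * #|` [fset x in cell g | Q x]%fset|%:R <=
                        b * #|` [fset x in cell g | Q' x]%fset|%:R) ->
  a * #|` [fset x in U | Q x]%fset|%:R <= b * #|` [fset x in U | Q' x]%fset|%:R.
Proof.
move=> [cell_refl cellE]; have [n] := ubnP #|` U|.
elim: n U => // n IH U Un Usat UQ.
have [->|/fset0Pn[g gU]] := eqVneq U fset0.
  have e0 (P : pred G) : [fset x in fset0 | P x]%fset = fset0 :> {fset G}.
    by apply/fsetP => x; rewrite !inE.
  by rewrite !e0 !mulr0.
have cgU := Usat g gU.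
have split_cell (P : pred G) : #|` [fset x in U | P x]%fset|%:R =
   #|` [fset x in cell g | P x]%fset|%:R + #|` [fset x in (U `\` cell g)%fset | P x]%fset|%:R :> R.
  rewrite -natrD -(cardfsID (cell g) [fset x in U | P x]%fset).
  have eq_card (A B : {fset G}) : A =i B -> #|` A| = #|` B| by move=> /fsetP ->.
  congr (_ + _)%:R; apply: eq_card => x; rewrite !inE /=; last by rewrite andbA.
  by case: (boolP (x \in cell g)) => [/(fsubsetP cgU) ->|_]; rewrite ?andbF ?andbT.
rewrite !split_cell !mulrDr lerD ?UQ // IH //.
- rewrite -ltnS; apply: leq_trans Un; rewrite ltnS.
  rewrite [ltnRHS](cardfsD1 g) gU add1n ltnS; apply: fsubset_card => x.
  by rewrite !inE => /andP[xg ->]; rewrite andbT; apply: contra xg => /eqP ->.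
- move=> h; rewrite inE => /andP[hg hU]; apply/fsubsetP => x xh.
  rewrite inE (fsubsetP (Usat h hU)) // andbT; apply: contra hg => xg.
  by rewrite -(cellE _ _ xg) (cellE _ _ xh).
- by move=> h; rewrite inE => /andP[_ /UQ].
Qed.

Lemma fset_filterT U : [fset x in U | true]%fset = U.
Proof. by apply/fsetP => x; rewrite !inE /= andbT. Qed.

Lemma rtranslateE F c : rtranslate F c = [set` [fset (g * c)%g | g in F]%fset].
Proof.
apply/seteqP; split=> x /=; first by move=> [g gF <-]; rewrite mem_rmul mulgK.
by move=> /imfsetP[g /= gF ->]; exists g.
Qed.

(** A cell translated so that its representative becomes [1] is a subset of [W], so finitely many
    shapes occur. [L] lists all candidates; one that never occurs gets an empty centre set. *)
Lemma multi_tile_of_cells (R : realType) S cell W (e : R) :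
  cell_partition cell -> 0 <= e ->
  (forall g h, h \in cell g -> (h * g^-1)%g \in W) ->
  (forall g, boundary_ratio S (cell g) <= e) ->
  exists m (F : 'I_m -> {fset G}),
    [/\ multi_tile F, forall i, (#|` F i| <= #|` W|)%N & max_ratio R S F <= e].
Proof.
move=> [cell_refl cellE] e0 cellW celle.
pose L : seq {fset G} := [seq A : {fset G} <- enum_fset (fpowerset W) | (1%g \in A) &&
    (boundary_ratio S A <= e)].
pose F (i : 'I_(size L)) : {fset G} := nth fset0 L i.
have FL i : F i \in L by rewrite mem_nth.
have uL : uniq L by apply/filter_uniq/fset_uniq.
exists (size L), F; split; last 2 first.
- by move=> i; move: (FL i); rewrite mem_filter fpowersetE => /andP[_] /fsubset_leq_card.
- by apply: bigmax_le => // i _; move: (FL i); rewrite mem_filter -andbA => /and3P[].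
split; first by move=> i; move: (FL i); rewrite mem_filter -andbA => /and3P[].
(* The default of [head] is never reached, so the representative depends on the cell alone and each
   cell has exactly one centre. *)
pose rep g := head g (cell g).
have repE g : rep g \in cell g := fset_head_mem (cell_refl g).
have rep_eq g h : cell g = cell h -> rep g = rep h.
  by rewrite /rep => gh; rewrite gh; apply: fset_head_eq (cell_refl h).
pose C i := [set c | rep c = c /\ [fset (h * c^-1)%g | h in cell c]%fset = F i].
have FC i c : C i c -> rtranslate (F i) c = [set` cell c].
  move=> [_ <-]; rewrite rtranslateE; apply/seteqP; split=> x /=;
    by rewrite !mem_rmul !invgK mulgVK.
exists C; split; last 1 first.
- by move=> [i c] /= /FC ->; exists c => /=.
- apply/seteqP; split=> // g _.
  have cg := cellE _ _ (repE g).
  pose c := rep g; have AL : [fset (h * c^-1)%g | h in cell c]%fset \in L.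
    rewrite mem_filter mem_rmul invgK mul1g cell_refl boundary_ratio_rmul celle /= fpowersetE.
    by apply/fsubsetP => x; rewrite mem_rmul invgK => /cellW; rewrite mulgK.
  move: (AL); rewrite -index_mem => iL.
  have Ci : C (Ordinal iL) c by split; [exact: rep_eq|rewrite /F /= nth_index].
  by exists (Ordinal iL, c) => //=; rewrite FC //= cg cell_refl.
move=> [i c] [j d] /= Ci Cj; rewrite (FC i) // (FC j) // => -[x [/= xc xd]].
have cd : cell c = cell d by rewrite -(cellE _ _ xc) (cellE _ _ xd).
have cd' : c = d by rewrite -Ci.1 -Cj.1; apply: rep_eq.
subst d; congr (_, _); apply/val_inj/eqP; rewrite -(nth_uniq fset0 (ltn_ord i) (ltn_ord j) uL).
by apply/eqP; rewrite -/(F i) -/(F j) -Ci.2 -Cj.2.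
Qed.

Lemma cells_of_multi_tile m (F : 'I_m -> {fset G}) : multi_tile F ->
  exists2 cell, cell_partition cell &
    forall g, exists i c, cell g = [fset (x * c)%g | x in F i]%fset.
Proof.
move=> [_ [C [Ccover Ctriv _]]].
have /choice[ic icP] (g : G) : exists ic : 'I_m * G,
    C ic.1 ic.2 /\ g \in [fset (x * ic.2)%g | x in F ic.1]%fset.
  have : [set: G] g by [].
  by rewrite -Ccover => -[[i c] /= Ci]; rewrite rtranslateE => /= xg; exists (i, c).
exists (fun g => [fset (x * (ic g).2)%g | x in F (ic g).1]%fset); last first.
  by move=> g; exists (ic g).1, (ic g).2.
split=> [g|g h hg]; first exact: (icP g).2.
rewrite (_ : ic h = ic g) //; apply: Ctriv; [exact: (icP h).1|exact: (icP g).1|].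
by exists h; rewrite !rtranslateE; split=> /=; [exact: (icP h).2|].
Qed.

End Cells.

(** * Greedy removal of partial translates *)

Section Greedy.
Context {G : groupType} {X : Type} (a : G -> X -> X) (V : {fset G})
  (B : nat -> set X) (t : nat).
Implicit Types (Y : set X) (x y : X) (v w : G) (D : {fset G}).

Definition pattern Y x : {fset G} := [fset v in V | `[< Y (a v x) >]]%fset.

Definition base Y k : set X := [set x | B k x /\ (t <= #|` pattern Y x|)%N].

Fixpoint rest k : set X :=
  if k is k'.+1
  then rest k' `&` ~` [set y | exists2 x, base (rest k') k' x & exists2 v, v \in V & a v x = y]
  else [set: X].

(* [y = a v x] belongs to the tile removed at stage [k] around the centre [x]. *)
Definition tile_at k v x y := [/\ base (rest k) k x, v \in V, a v x = y & rest k y].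

Definition leftover : set X := \bigcap_k rest k.

(** The boundary is that of the full translate, not of the tile, so the number of edge points per
    tile is bounded independently of what earlier stages removed. *)
Definition edge D : set X :=
  [set y | exists k v x, tile_at k v x y /\ v \in boundary D V].

Lemma patternP Y x v : reflect (v \in V /\ Y (a v x)) (v \in pattern Y x).
Proof. by rewrite !inE; apply: (iffP andP) => -[vV /asboolP]. Qed.

Lemma rest_anti m n : (m <= n)%N -> rest n `<=` rest m.
Proof.
by move=> /subnKC <-; elim: (n - m)%N => [|i IH]; rewrite ?addn0 // addnS => y /= [/IH].
Qed.

Lemma rest_tile_at k v x y : tile_at k v x y -> ~ rest k.+1 y.
Proof. by move=> [bx vV vx _] [_]; apply; exists x => //; exists v. Qed.

Lemma tile_atP k y : rest k y -> ~ rest k.+1 y -> exists v x, tile_at k v x y.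
Proof.
move=> yk /= /not_andP[//|/contrapT[x bx [v vV vx]]].
by exists v, x.
Qed.

Lemma tile_at_lt k y : ~ rest k y -> exists2 j, (j < k)%N & exists v x, tile_at j v x y.
Proof.
elim: k => [|k IH] yk; first by case: yk.
have [yk'|/IH[j jk h]] := pselect (rest k y); last by exists j => //; exact: ltnW.
by exists k => //; exact: tile_atP.
Qed.

Lemma tile_at_ex y : ~ leftover y -> exists k v x, tile_at k v x y.
Proof.
by move=> /existsNP[k /not_implyP[_ /tile_at_lt[j _ h]]]; exists j.
Qed.

Lemma leftover_tile_at k v x y : tile_at k v x y -> ~ leftover y.
Proof. by move=> h /(_ k.+1 I); exact: rest_tile_at h. Qed.

Lemma tile_at_pattern k v x y w : tile_at k v x y -> w \in pattern (rest k) x ->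
  tile_at k w x (a w x).
Proof. by move=> [bx _ _ _] /patternP[wV wx]. Qed.

Lemma mem_pattern k v x y : tile_at k v x y -> v \in pattern (rest k) x.
Proof. by move=> [_ vV <- yk]; apply/patternP. Qed.

Hypothesis B_sep : forall k x y v w, B k x -> B k y -> v \in V -> w \in V ->
  a v x = a w y -> x = y /\ v = w.

Lemma tile_at_inj k v x k' v' x' y :
  tile_at k v x y -> tile_at k' v' x' y -> [/\ k = k', v = v' & x = x'].
Proof.
move=> h h'; have [kk'|kk'|kk'] := ltngtP k k'.
- by case: h' => _ _ _ /(rest_anti kk') /(rest_tile_at h).
- by case: h => _ _ _ /(rest_anti kk') /(rest_tile_at h').
- subst k'; case: h => [[bx _] vV vx _]; case: h' => [[bx' _] vV' vx' _].
  by have [|-> ->] := B_sep bx bx' vV vV'; first by rewrite vx.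
Qed.

(** A translate that met the threshold at stage [k] has lost all its points; one that did not had
    fewer than [t] of them left. *)
Lemma leftover_count k x : (0 < t)%N -> B k x -> (#|` pattern leftover x| < t)%N.
Proof.
move=> t0 bx; have [tx|] := leqP t #|` pattern (rest k) x|; last first.
  apply: leq_ltn_trans; apply: fsubset_card => v /patternP[vV vL].
  by apply/patternP; split=> //; exact: vL.
rewrite (_ : pattern _ _ = fset0) ?cardfs0 //; apply/fsetP => v; rewrite inE.
apply/patternP => -[vV vL]; have := vL k.+1 I; apply: (@rest_tile_at k v x).
by split=> //; exact: vL.
Qed.

Hypothesis aM : forall g h x, a (g * h)%g x = a g (a h x).
Hypothesis a1 : forall x, a 1%g x = x.

(* If [a d y] was removed before stage [k], then [y] was not in the translate of
   [V] that removed it, so [a d y] lies on the edge of its own translate. *)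
Lemma edge_neighbor D k v x y d : symmetric_fset D -> tile_at k v x y -> d \in D ->
  ~ ((d * v)%g \in V /\ rest k (a d y)) -> edge D y \/ edge D (a d y).
Proof.
move=> Dsym h dD; have [dvV|dvV] := boolP ((d * v)%g \in V); last first.
  move=> _; left; exists k, v, x; split=> //; apply/boundaryP; split; last by exists d.
  by case: h.
move=> /not_andP[//|/tile_at_lt[j jk [v' [x' h']]]]; right; exists j, v', x'; split=> //.
apply/boundaryP; split; first by case: h'.
exists (d^-1)%g; first exact: Dsym.
apply/negP => dv'; case: h => _ _ _ yk; have := rest_anti jk yk.
apply: (@rest_tile_at j (d^-1 * v')%g x').
case: h' => bx' _ v'x' _; split=> //; first by rewrite aM v'x' -aM mulVg a1.
exact: rest_anti (ltnW jk) _ yk.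
Qed.

End Greedy.

(** * Counting in translates *)

Section Counting.
Context {G : groupType}.
Implicit Types (S F U W P Y : {fset G}) (cell : G -> {fset G}) (g h c x y : G).

Lemma saturated_countn cell U (Q Q' : pred G) (a b : nat) :
  cell_partition cell ->
  (forall g, g \in U -> (cell g `<=` U)%fset) ->
  (forall g, g \in U -> (a * #|` [fset x in cell g | Q x]%fset| <=
                         b * #|` [fset x in cell g | Q' x]%fset|)%N) ->
  (a * #|` [fset x in U | Q x]%fset| <= b * #|` [fset x in U | Q' x]%fset|)%N.
Proof.
move=> cellP Usat UQ; rewrite -(ler_nat int) !natrM.
by apply: saturated_count cellP Usat _ => g /UQ; rewrite -(ler_nat int) !natrM.
Qed.

Definition saturation cell U : {fset G} := (\bigcup_(g <- U) cell g)%fset.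

Lemma saturationP cell U x :
  reflect (exists2 g, g \in U & x \in cell g) (x \in saturation cell U).
Proof. exact: nbhdP. Qed.

Lemma saturationS cell U x : cell_partition cell -> x \in saturation cell U ->
  (cell x `<=` saturation cell U)%fset.
Proof.
move=> [_ cellE] /saturationP[g gU xg]; apply/fsubsetP => y.
by rewrite (cellE _ _ xg) => yg; apply/saturationP; exists g.
Qed.

Lemma sub_saturation cell U x : cell_partition cell -> x \in U -> x \in saturation cell U.
Proof. by move=> [cell_refl _] xU; apply/saturationP; exists x. Qed.

(** A point [x] lies in [W y] for at most [#|W|] centres [y]. The next lemma is the converse: all
    these centres count once [W^-1 x] lies in [Y]. *)
Lemma translate_count_le W Y P :
  (\sum_(y <- Y) #|` [fset x in P | (x * y^-1)%g \in W]%fset| <= #|` W| * #|` P|)%N.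
Proof.
rewrite double_count (card_fset_sum1 P) big_distrr /=; apply: leq_sum => x _; rewrite muln1.
apply: (@leq_card_inj _ _ (fun y => (x * y^-1)%g)) => [u v _ _ /mulgI/invg_inj //|y].
by rewrite !inE => /andP[].
Qed.

Lemma translate_count W Y P : (fmul (finv W) P `<=` Y)%fset ->
  (#|` W| * #|` P| <= \sum_(y <- Y) #|` [fset x in P | (x * y^-1)%g \in W]%fset|)%N.
Proof.
move=> /fsubsetP WPY.
rewrite double_count (card_fset_sum1 P) big_distrr /= big_seq [leqRHS]big_seq.
apply: leq_sum => x xP; rewrite muln1.
apply: (@leq_card_inj _ _ (fun w => (w^-1 * x)%g)) => [u v _ _ /mulIg/invg_inj //|w wW].
rewrite !inE /= invgM mulVKg invgK wW andbT.
by apply: WPY; apply: mem_fmul; rewrite ?mem_finv.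
Qed.

(** Average over the centres [c] in [F^-1 U]. The density is taken against this enlarged set, which
    is harmless when [U] is almost invariant. *)
Lemma translate_density F U (L : pred G) (m : nat) :
  (forall c, (#|` [fset v in F | L (v * c)%g]%fset| <= m)%N) ->
  (#|` F| * #|` [fset x in U | L x]%fset| <= m * #|` fmul (finv F) U|)%N.
Proof.
move=> Lm; apply: leq_trans (@translate_count F (fmul (finv F) U) _ _) _.
  apply/fsubsetP => x /fmulP[v [y [vF]]]; rewrite inE /= => /andP[yU _] ->.
  exact: mem_fmul.
rewrite (card_fset_sum1 (fmul _ _)) big_distrr /=; apply: leq_sum => c _; rewrite muln1.
apply: leq_trans (Lm c); apply: (@leq_card_inj _ _ (fun x => (x * c^-1)%g)) => [u v _ _ /mulIg
    //|x].
by rewrite !inE /= => /andP[/andP[_ Lx] xF]; rewrite xF mulgVK.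
Qed.

End Counting.

Section Generation.
Context {G : groupType} (S : {fset G}).
Hypotheses (S_sym : symmetric_fset S) (S_gen : generates S).

Lemma group_enum : exists e : nat -> G, forall g, exists k, e k = g.
Proof.
pose prod (w : seq nat) : G := foldr (fun i g => (nth 1%g S i * g)%g) 1%g w.
have prod_cat w1 w2 : prod (w1 ++ w2) = (prod w1 * prod w2)%g.
  by elim: w1 => [|i w IH] /=; rewrite ?mul1g // IH mulgA.
have gen1 g : g \in S -> exists i, nth 1%g S i = g.
  by move=> gS; exists (index g S); rewrite nth_index.
have /S_gen : is_subgroup [set g | exists w, prod w = g].
  split=> [|_ _ [w1 <-] [w2 <-]|_ [w <-]]; first by exists [::].
    by exists (w1 ++ w2).
  elim: w => [|i w [w' IH]] /=; first by exists [::]; rewrite invg1.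
  rewrite invgM -IH; have [iS|iS] := ltnP i #|` S|.
    have [j jP] := gen1 _ (S_sym (mem_nth 1%g iS)).
    by exists (w' ++ [:: j]); rewrite prod_cat /= jP mulg1.
  by rewrite (nth_default _ iS) invg1 mulg1; exists w'.
move=> /(_ _)-GE; have {}GE : [set g | exists w, prod w = g] = setT.
  by apply: GE => g /= /gen1[i <-]; exists [:: i]; rewrite /= mulg1.
exists (fun k => prod (odflt [::] (choice.unpickle k))) => g.
have [w <-] : [set g | exists w, prod w = g] g by rewrite GE.
by exists (choice.pickle w); rewrite choice.pickleK.
Qed.

(** A set without boundary is stable under [S], hence under the whole group, which would then lie in
    the finite set [F f^-1]. A nonzero boundary turns a bound on its size relative to [t] into a
    lower bound on the size of tiles. *)
Lemma boundary_neq0 F : infinite_set [set: G] -> F != fset0 -> boundary S F != fset0.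
Proof.
move=> G_inf /fset0Pn[f fF]; apply/negP => /eqP F0; apply: G_inf.
have SF s x : s \in S -> x \in F -> (s * x)%g \in F.
  move=> sS xF; apply/negPn/negP => sx; have : x \in boundary S F.
    by apply/boundaryP; split=> //; exists s.
  by rewrite F0.
have /S_gen/(_ _)-GE : is_subgroup [set g | forall x,
    x \in F -> (g * x)%g \in F /\ (g^-1 * x)%g \in F].
  split=> [x xF|g h gF hF x xF|g gF x /gF[]]; rewrite ?invg1 ?mul1g ?invgK //.
  rewrite invgM -!mulgA; split; first by apply: (gF _ _).1; exact: (hF _ _).1.
  by apply: (hF _ _).2; exact: (gF _ _).2.
have {}GE := GE (fun s sS x xF => conj (SF _ _ sS xF) (SF _ _ (S_sym sS) xF)).
rewrite -{}GE.
apply: (@sub_finite_set _ _ [set` [fset (x * f^-1)%g | x in F]%fset]); last exact: finite_fset.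
by move=> g /(_ _ fF)[gf _]; rewrite /= mem_rmul invgK.
Qed.
End Generation.

(** * Exact tilings by almost invariant sets *)

Section QuasiTiling.
Context {R : realType} {G : groupType} (S : {fset G}).
Hypotheses (S_sym : symmetric_fset S) (S_gen : generates S)
  (G_inf : infinite_set [set: G]) (G_amen : amenable_group R G).

Section Tiles.
Variables (e : nat -> G) (F : {fset G}) (t : nat).

Let B k : set G := [set e k].
Let tile k v x y := @tile_at G G (fun g x => g * x)%g F B t k v x y.
Let L := @leftover G G (fun g x => g * x)%g F B t.
Let E := @edge G G (fun g x => g * x)%g F B t S.

Let B_sep k (x y v w : G) : B k x -> B k y -> v \in F -> w \in F ->
  (v * x)%g = (w * y)%g -> x = y /\ v = w.
Proof. by move=> -> -> _ _ /mulIg. Qed.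

(** [G] acts on itself by left multiplication, with the single centre [e k] at stage [k]. Leftover
    points are singleton cells, whence the [1] added to [F F^-1]. Distinct points of a tile have
    distinct positions in [F], which bounds its edge points. *)
Lemma greedy_cells : exists cell, [/\ cell_partition cell,
  forall g h, h \in cell g -> (h * g^-1)%g \in (1%g |` fmul F (finv F))%fset,
  forall g h, h \in cell g -> L h -> L g,
  forall g, ~ L g -> (t <= #|` cell g|)%N &
  (forall g, (#|` [fset h in cell g | `[< E h >]]%fset| <= #|` boundary S F|)%N) /\
  (forall g h, ~ L g -> h \in boundary S (cell g) ->
    E h \/ exists2 s, s \in S & E (s * h)%g)] /\
  (forall g, E g -> ~ L g).
Proof.
pose pat k x := pattern (fun g x => g * x)%g F (@rest G G (fun g x => g * x)%g F B t k) x.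
have /choice[cell cellP] y : exists A, (exists k v x,
    tile k v x y /\ A = [fset (w * x)%g | w in pat k x]%fset)
    \/ (L y /\ A = [fset y]%fset).
  have [Ly|Ly] := pselect (L y); first by exists [fset y]%fset; right.
  have [k [v [x h]]] := tile_at_ex Ly.
  by exists [fset (w * x)%g | w in pat k x]%fset; left; exists k, v, x.
have tile_inj k v x k' v' x' y : tile k v x y -> tile k' v' x' y -> [/\ k = k', v = v' & x = x'].
  by move=> h h'; exact: (tile_at_inj B_sep h h').
have tileL y : L y -> forall k v x, ~ tile k v x y.
  by move=> Ly k v x h; exact: leftover_tile_at h Ly.
have cell_tile k v x y : tile k v x y -> cell y = [fset (w * x)%g | w in pat k x]%fset.
  move=> h; case: (cellP y) => [[k' [v' [x' [h' ->]]]]|[/tileL/(_ _ _ _ h)//]].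
  by have [-> _ ->] := tile_inj _ _ _ _ _ _ _ h h'.
have cellE g h : h \in cell g -> cell h = cell g.
  case: (cellP g) => [[k [v [x [gP ->]]]]|[Lg ->]]; last by rewrite inE => /eqP ->;
      case: (cellP g) => [[k [v [x [/(tileL _ Lg)]]]]|[_ ->]].
  by move=> /imfsetP[w /= wP ->]; apply: (@cell_tile k w); exact: tile_at_pattern gP wP.
exists cell; split; last by move=> g [k [v [x [h _]]]] /tileL/(_ _ _ _ h).
split; [| | | |split].
- split=> // g; case: (cellP g) => [[k [v [x [gP ->]]]]|[_ ->]]; last by rewrite inE.
  by rewrite mem_rmul; case: (gP) => _ _ <- _; rewrite mulgK; exact: mem_pattern gP.
- move=> g h; case: (cellP g) => [[k [v [x [gP ->]]]]|[_ ->]]; last first.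
    by rewrite !inE => /eqP ->; rewrite mulgV eqxx.
  move=> /imfsetP[w /= /patternP[wF _] ->]; rewrite in_fsetU; apply/orP; right.
  by case: gP => _ vF <- _; rewrite invgM mulgA mulgK mem_fmul ?mem_finv.
- move=> g h; case: (cellP g) => [[k [v [x [gP ->]]]]|[_ ->]]; last by rewrite !inE => /eqP ->.
  by move=> /imfsetP[w /= wP ->] /tileL; case/(_ k w x); exact: (tile_at_pattern gP wP).
- move=> g; case: (cellP g) => [[k [v [x [gP ->]]]]|[//]] _.
  by rewrite card_rmul; case: gP => [[]].
- move=> g; case: (cellP g) => [[k [v [x [gP ->]]]]|[Lg ->]]; last first.
    rewrite (_ : [fset h in _ | _]%fset = fset0) ?cardfs0 //; apply/fsetP => h; rewrite !inE /=.
    by apply/negP => /andP[/eqP ->] /asboolP[k [v [x [/(tileL _ Lg)]]]].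
  apply: (@leq_card_inj _ _ (fun h => (h * x^-1)%g)) => [u v' _ _ /mulIg //|h].
  rewrite !inE /= mem_rmul => /andP[hP /asboolP[k' [v' [x' [hP' v'F]]]]].
  have := tile_at_pattern gP hP; rewrite /= mulgVK => hP2.
  have [_ v'E _] := tile_inj _ _ _ _ _ _ _ hP' hP2.
  by move: v'F; rewrite v'E !inE.
- move=> g h; case: (cellP g) => [[k [v [x [gP ->]]]]|[Lg _]] nLg; last by case: nLg.
  move=> /boundaryP[hA [s sS sh]].
  rewrite mem_rmul in hA; rewrite mem_rmul in sh.
  have := tile_at_pattern gP hA; rewrite /= mulgVK => hP.
  have nsh : ~ ((s * (h * x^-1))%g \in F /\ @rest G G (fun g x => g * x)%g F B t k (s * h)%g).
    move=> [sF sR]; move/negP: sh; apply; apply/patternP.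
    by split; [rewrite -mulgA|rewrite mulgVK].
  have := edge_neighbor (fun g h x => esym (mulgA g h x)) (@mul1g G) S_sym hP sS nsh.
  by move=> [Eh|Esh]; [left|right; exists s].
Qed.
End Tiles.

Lemma fmul_rmul (A W : {fset G}) y : fmul A [fset (w * y)%g | w in W]%fset =
  [fset (w * y)%g | w in fmul A W]%fset.
Proof.
apply/fsetP => z; rewrite mem_rmul; apply/fmulP/fmulP.
  move=> [x [u [xA]]]; rewrite mem_rmul => uW ->.
  by exists x, (u * y^-1)%g; rewrite mulgA.
move=> [x [u [xA uW zE]]]; exists x, (u * y)%g; rewrite mem_rmul mulgK; split=> //.
by rewrite mulgA -zE mulgVK.
Qed.

Lemma fmulS (A B C D : {fset G}) : (A `<=` B)%fset -> (C `<=` D)%fset ->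
  (fmul A C `<=` fmul B D)%fset.
Proof.
move=> /fsubsetP AB /fsubsetP CD; apply/fsubsetP => x /fmulP[y [z [/AB yB /CD zD ->]]].
exact: mem_fmul.
Qed.

Lemma fmulA (A B C : {fset G}) : fmul (fmul A B) C = fmul A (fmul B C).
Proof.
apply/fsetP => x; apply/fmulP/fmulP.
  move=> [_ [c [/fmulP[u [b [uA bB ->]]] cC ->]]].
  by exists u, (b * c)%g; rewrite mulgA mem_fmul.
move=> [u [_ [uA /fmulP[b [c [bB cC ->]]] ->]]].
by exists (u * b)%g, c; rewrite mulgA mem_fmul.
Qed.

Lemma saturation_fmul cell (M U : {fset G}) :
  (forall g h, h \in cell g -> (h * g^-1)%g \in M) ->
  (saturation cell U `<=` fmul M U)%fset.
Proof.
move=> cellM; apply/fsubsetP => h /saturationP[g gU /cellM hg].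
by rewrite -(mulgVK g h) mem_fmul.
Qed.

(** [Z] collects the leftover points and the tiles with too large a boundary. Each kind fills at
    most [1 / (8 q)] of any translate of the window [W], whence the [4 q]. *)
Lemma quasi_tiling (q : nat) : (0 < q)%N -> exists (cell : G -> {fset G}) (M W : {fset G}) (Z :
    pred G),
  [/\ cell_partition cell,
    forall g h, h \in cell g -> (h * g^-1)%g \in M,
    forall g h, h \in cell g -> Z h = Z g,
    forall g, ~~ Z g ->
      (q <= #|` cell g|)%N /\ (q * #|` boundary S (cell g)| <= #|` cell g|)%N &
    W != fset0 /\ forall y, (4 * q * #|` [fset w in W | Z (w * y)%g]%fset| <= #|` W|)%N].
Proof.
move=> q0; have [e e_onto] := group_enum S_sym S_gen.
(* [E] has density at most [1 / p] up to a factor 2, hence the bad tiles have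
   density at most [2 q (#|S| + 1) / p = 1 / (8 q)]. *)
pose p := (16 * q * q * (#|` S|).+1)%N.
have [F F0 Fp] := folner_boundary G_amen S (16 * q * p)%N.
have bF0 : (0 < #|` boundary S F|)%N by rewrite cardfs_gt0 boundary_neq0.
(* A translate of [F] then has at most [#|F| / (16 q)] leftover points; the factor 2 lost by
   enlarging the window gives [1 / (8 q)]. *)
pose t := (#|` F| %/ (16 * q)).+1.
have tF : (#|` F| < 16 * q * t)%N by rewrite mulnC ltn_ceil // muln_gt0.
have [cell [[cellP cellM cellL cellt [cellE cellB]] EL]] := greedy_cells e F t.
have cell_sym g h : h \in cell g -> g \in cell h.
  by move=> hg; rewrite (cellP.2 _ _ hg); exact: cellP.1.
set L := leftover _ _ _ _ in cellL cellt cellB EL.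
set E := edge _ _ _ _ _ in cellE cellB EL.
set M1 := (1%g |` _)%fset in cellM.
pose S1 := (1%g |` S)%fset.
(* [finv F] serves the averaging over translates of [F]; the product allows a saturation by cells, a
   step by a generator and a second saturation, as in [U1], [U2], [U3]. *)
pose M2 := (finv F `|` fmul M1 (fmul S1 M1))%fset.
have [W W0 WM2] := folner_product G_amen M2.
pose bad g := ~ L g /\ (#|` cell g| < q * #|` boundary S (cell g)|)%N.
pose E' h := E h \/ exists2 s, s \in S & E (s * h)%g.
have badE g h : h \in cell g -> bad h <-> bad g.
  move=> hg; rewrite /bad (cellP.2 _ _ hg); split=> -[nL lt]; split=> // Lg; apply: nL.
    by apply: cellL Lg; exact: cell_sym.
  exact: cellL Lg.
have pt : (p * #|` boundary S F| < t)%N.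
  rewrite -(ltn_pmul2l (m := 16 * q)) ?muln_gt0 // mulnA.
  exact: leq_ltn_trans Fp tF.
exists cell, M1, W, (fun g => `[< L g \/ bad g >]); split=> //.
- move=> g h hg; apply/asbool_equiv_eq; split=> -[Lg|/(badE _ _ hg)]; auto; left.
    exact: cellL hg Lg.
  exact: cellL (cell_sym _ _ hg) Lg.
- move=> g /asboolP/not_orP[nL nbad]; split.
    apply: leq_trans (cellt g nL); apply: leq_trans (ltnW pt).
    by apply: leq_trans (leq_pmulr p bF0);
        rewrite /p -!mulnA mulnC -!mulnA leq_pmulr // !muln_gt0 q0.
  by rewrite leqNgt; apply/negP => lt; apply: nbad.
split=> // y.
pose U : {fset G} := [fset (w * y)%g | w in W]%fset.
have cardM2 (A : {fset G}) : (A `<=` M2)%fset -> (#|` fmul A U| <= 2 * #|` W|)%N.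
  move=> AM2; rewrite fmul_rmul card_rmul; apply: leq_trans WM2.
  by apply/fsubset_leq_card/fmulS.
have LU : (16 * q * #|` [fset x in U | `[< L x >]]%fset| <= 2 * #|` W|)%N.
  apply: leq_trans (cardM2 _ (fsubsetUl _ _)).
  have F_gt0 : (0 < #|` F|)%N by rewrite cardfs_gt0.
  rewrite -(leq_pmul2l F_gt0) mulnCA.
  have Lm c : (#|` [fset v in F | `[< L (v * c)%g >]]%fset| <= #|` F| %/ (16 * q))%N.
    have [k kc] := e_onto c; rewrite -ltnS.
    apply: (@leftover_count G G (fun g x => g * x)%g F (fun k => [set e k]) t k c) => //.
  have := translate_density U (L := fun x => `[< L x >]) Lm; rewrite -/U.
  move=> /(leq_mul (leqnn (16 * q)%N)) h; apply: leq_trans h _.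
  by rewrite mulnA leq_mul2r [(16 * q * _)%N]mulnC leq_divM orbT.
have badU : (16 * q * #|` [fset x in U | `[< bad x >]]%fset| <= 2 * #|` W|)%N.
  pose U1 := saturation cell U; pose U2 := fmul S1 U1; pose U3 := saturation cell U2.
  have U3M : (U3 `<=` fmul (fmul M1 (fmul S1 M1)) U)%fset.
    apply: fsubset_trans (saturation_fmul _ cellM) _.
    rewrite !fmulA; apply: fmulS => //; apply: fmulS => //; exact: saturation_fmul.
  have EU3 : (p * #|` [fset x in U3 | `[< E x >]]%fset| <= #|` U3|)%N.
    rewrite -[leqRHS]mul1n -[X in (1 * #|` X|)%N]fset_filterT.
    apply: (saturated_countn cellP) => g; first exact: saturationS.
    move=> _; rewrite fset_filterT mul1n; have [Lg|nLg] := pselect (L g); last first.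
      apply: leq_trans (leq_mul (leqnn p) (cellE g)) _.
      exact: leq_trans (ltnW pt) (cellt g nLg).
    rewrite (_ : [fset x in _ | _]%fset = fset0) ?cardfs0 ?muln0 //.
    apply/fsetP => h; rewrite !inE /=; apply/negP => /andP[hg /asboolP/EL]; apply.
    exact: cellL (cell_sym _ _ hg) Lg.
  have E'U1 : (#|` [fset x in U1 | `[< E' x >]]%fset| <=
      (#|` S|).+1 * #|` [fset x in U3 | `[< E x >]]%fset|)%N.
    apply: (@leq_trans (#|` finv S1| * #|` [fset x in U3 | `[< E x >]]%fset|)%N); last first.
      rewrite leq_mul2r; apply/orP; right; apply: leq_trans (leq_imfset_card _ _ _) _ => /=.
      by rewrite cardfsU1; case: (_ \notin _).
    apply: leq_trans (card_fmul_le _ _); apply: fsubset_card => h.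
    rewrite !inE /= => /andP[hU1 /asboolP E'h].
    have [s sS1 Esh] : exists2 s, s \in S1 & E (s * h)%g.
      case: E'h => [Eh|[s sS Eh]]; first by exists 1%g; rewrite ?mul1g // !inE eqxx.
      by exists s => //; rewrite !inE sS orbT.
    rewrite -(mulKg s h) mem_fmul ?mem_finv // !inE /=; apply/andP; split; last exact/asboolP.
    by apply: sub_saturation => //; exact: mem_fmul.
  (* Every boundary point of a bad tile lies in [E'], and the tile has fewer than [q] points per
     boundary point. *)
  have badU1 : (1 * #|` [fset x in U1 | `[< bad x >]]%fset| <=
      q * #|` [fset x in U1 | `[< E' x >]]%fset|)%N.
    apply: (saturated_countn cellP) => g; first exact: saturationS.
    move=> _; rewrite mul1n; have [bg|nbg] := pselect (bad g); last first.
      rewrite (_ : [fset x in _ | _]%fset = fset0) ?cardfs0 //.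
      apply/fsetP => h; rewrite !inE /=; apply/negP => /andP[hg /asboolP/(badE _ _ hg)].
      exact: nbg.
    have [nLg /ltnW lt] := bg; apply: leq_trans (leq_trans lt _).
      by apply: fsubset_card => h; rewrite !inE /= => /andP[].
    rewrite leq_mul2l; apply/orP; right; apply: fsubset_card => h hb.
    rewrite !inE /=; apply/andP; split; first by case/boundaryP: hb.
    by apply/asboolP; exact: cellB hb.
  have UU1 : (#|` [fset x in U | `[< bad x >]]%fset| <= #|` [fset x in U1 | `[< bad x >]]%fset|)%N.
    apply: fsubset_card => h; rewrite !inE /= => /andP[hU ->]; rewrite andbT.
    exact: sub_saturation.
  have := cardM2 _ (fsubsetUr _ _); have := fsubset_leq_card U3M.
  by move: UU1 badU1 E'U1 EU3; rewrite /p; clear; nia.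
have : (#|` [fset w in W | `[< L (w * y)%g \/ bad (w * y)%g >]]%fset| <=
  #|` [fset x in U | `[< L x >]]%fset| + #|` [fset x in U | `[< bad x >]]%fset|)%N.
  apply: leq_trans (leq_card_fsetU _ _).
  apply: (@leq_card_inj _ _ (fun w => (w * y)%g)) => [u v _ _ /mulIg //|w].
  rewrite !inE /= => /andP[wW /asboolP h]; rewrite !mem_rmul mulgK wW /=.
  by apply/orP; case: h => h; [left|right]; exact/asboolP.
by move: LU badU; clear; nia.
Qed.
End QuasiTiling.

(** * Redistribution of the sparse bad points over the good tiles *)

Section Redistribution.
Context {G : groupType}.
Variables (S : {fset G}) (q : nat) (cell : G -> {fset G}) (M W : {fset G}) (Z : pred G).
Hypotheses (q0 : (0 < q)%N) (cellP : cell_partition cell)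
  (cellM : forall g h, h \in cell g -> (h * g^-1)%g \in M)
  (cellZ : forall g h, h \in cell g -> Z h = Z g)
  (cell_large : forall g, ~~ Z g -> (q <= #|` cell g|)%N)
  (cell_folner : forall g, ~~ Z g -> (q * #|` boundary S (cell g)| <= #|` cell g|)%N)
  (W0 : W != fset0)
  (WZ : forall y, (4 * q * #|` [fset w in W | Z (w * y)%g]%fset| <= #|` W|)%N).

Let D := fmul W (finv W).

(** A tile accepts at most one new point per [q] of its own. Slots are actual points of the tile, so
    an injective map into points bounds the growth of every tile. *)
Definition slot (A : {fset G}) : {fset G} := [fset x in take (#|` A| %/ q) (enum_fset A)]%fset.

Lemma slot_sub A x : x \in slot A -> x \in A.
Proof. by rewrite !inE /= => /mem_take. Qed.

Lemma card_slot A : #|` slot A| = (#|` A| %/ q)%N.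
Proof.
rewrite card_fseq undup_id ?take_uniq // size_take.
by case: ltnP => // /(conj (leq_div #|` A| q))/andP/anti_leq.
Qed.

Definition slots z : {fset G} :=
  (\bigcup_(g <- fmul D [fset z]%fset) if Z g then fset0 else slot (cell g))%fset.

Lemma slotsP z x : reflect (exists g, [/\ ~~ Z g, (g * z^-1)%g \in D & x \in slot (cell g)])
  (x \in slots z).
Proof.
apply: (iffP (nbhdP _ _ _)) => [[g /fmulP[d [_ [dD /fset1P -> ->]]]]|[g [Zg gD xg]]].
  by case: ifP => // /negbT Zg xg; exists (d * z)%g; rewrite mulgK.
exists g; last by rewrite (negbTE Zg).
by rewrite -(mulgVK z g) mem_fmul // inE.
Qed.

(* Average over the translates of [W] that meet [P]: in each of them the points of
   [P] are [2 q] times fewer than the good points, and a good tile has one slot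
   per [2 q] points at least. *)
Lemma slots_hall : hall_condition [set` Z] slots.
Proof.
move=> P PZ.
pose Y := fmul (finv W) P.
pose U := [fset g in fmul W Y | ~~ Z g]%fset.
pose U' := saturation cell U.
have UU' : (#|` U| <= #|` U'|)%N by apply: fsubset_card => x; exact: sub_saturation.
have U'Z g : g \in U' -> ~~ Z g.
  by move=> /saturationP[h]; rewrite !inE /= => /andP[_ Zh] /cellZ ->.
have U'slots : (#|` U'| <= 2 * q * #|` nbhd slots P|)%N.
  rewrite -[leqLHS]mul1n -[X in (1 * #|` X|)%N]fset_filterT.
  apply: (@leq_trans (2 * q * #|` [fset x in U' | x \in slot (cell x)]%fset|)%N).
    apply: (saturated_countn cellP) => g; first exact: saturationS.
    move=> /U'Z Zg; rewrite mul1n fset_filterT.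
    apply: (@leq_trans (2 * q * #|` slot (cell g)|)%N).
      (* There is at least one slot by [cell_large], so rounding [#|cell g| / q] down costs at most
         a factor 2. *)
      rewrite card_slot; apply: ltnW; apply: leq_trans (ltn_ceil _ q0) _.
      have : (0 < #|` cell g| %/ q)%N by rewrite divn_gt0 // cell_large.
      by set k := (_ %/ _)%N; clearbody k; clear; nia.
    rewrite leq_mul2l; apply/orP; right; apply: fsubset_card => x xg.
    by rewrite in_fset_filter (slot_sub xg) (cellP.2 _ _ (slot_sub xg)).
  rewrite leq_mul2l; apply/orP; right; apply: fsubset_card => x.
  rewrite in_fset_filter => /andP[/saturationP[g]]; rewrite in_fset_filter => /andP[gWY Zg] xg xs.
  have [w [_ [wW /fmulP[v [p [vW pP ->]]] gE]]] := fmulP _ _ _ gWY.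
  apply/nbhdP; exists p => //; apply/slotsP; exists g; rewrite -(cellP.2 _ _ xg); split=> //.
  by rewrite gE mulgA mulgK mem_fmul.
have PU : (2 * q * #|` P| <= #|` U|)%N.
  have W_gt0 : (0 < #|` W|)%N by rewrite cardfs_gt0.
  rewrite -(leq_pmul2l W_gt0) mulnCA.
  apply: leq_trans (leq_mul (leqnn _) (translate_count (fsubset_refl Y))) _.
  apply: leq_trans (translate_count_le W Y U).
  rewrite big_distrr /= big_seq [leqRHS]big_seq; apply: leq_sum => y yY.
  pose bad := [fset w in W | Z (w * y)%g]%fset.
  pose good := [fset w in W | ~~ Z (w * y)%g]%fset.
  have WE : (#|` bad| + #|` good| = #|` W|)%N.
    rewrite -(cardfsID bad W); congr (_ + _)%N; congr (size (enum_fset _));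
      apply/fsetP => w; rewrite !inE /=; case: (w \in W) => //=; rewrite ?andbT //.
  have Pbad : (#|` [fset x in P | (x * y^-1)%g \in W]%fset| <= #|` bad|)%N.
    apply: (@leq_card_inj _ _ (fun x => (x * y^-1)%g)) => [u v _ _ /mulIg //|x].
    by rewrite !inE /= mulgVK => /andP[/PZ xZ ->].
  have goodU : (#|` good| <= #|` [fset x in U | (x * y^-1)%g \in W]%fset|)%N.
    apply: (@leq_card_inj _ _ (fun w => (w * y)%g)) => [u v _ _ /mulIg //|w].
    by rewrite !inE /= mulgK => /andP[wW ->]; rewrite wW mem_fmul.
  apply: leq_trans goodU; rewrite -(leq_add2l #|` bad|) WE; apply: leq_trans (WZ y).
  rewrite -/bad; apply: leq_trans (leq_add (leq_pmull _ q0) (leq_mul (leqnn (2 * q)%N) Pbad)) _.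
  by rewrite -!mulnA; clear; lia.
rewrite -(leq_pmul2l (m := 2 * q)) ?muln_gt0 //.
apply: leq_trans PU (leq_trans UU' U'slots).
Qed.

(** [anchor g] is the good tile that finally receives [g]; sharing a new cell means sharing the
    anchor, which gives the partition at once. At most a proportion [1 / q] is added to a tile, and
    the new boundary lies in the old one together with the added points, whence the factor 2. *)
Lemma folner_partition : exists cell' (M' : {fset G}),
  [/\ cell_partition cell', forall g h, h \in cell' g -> (h * g^-1)%g \in M' &
    forall g, (q * #|` boundary S (cell' g)| <= 2 * #|` cell' g|)%N].
Proof.
have [f fslots finj] := hall_matching 1%g slots_hall.
pose anchor g := if Z g then cell (f g) else cell g.
have cell_sym g h : h \in cell g -> g \in cell h.
  by move=> hg; rewrite (cellP.2 _ _ hg); exact: cellP.1.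
have fP z : Z z -> exists g, [/\ ~~ Z g, (g * z^-1)%g \in D,
    cell (f z) = cell g & f z \in slot (cell g)].
  move=> /fslots/slotsP[g [Zg gD fzg]]; exists g; split=> //.
  exact: cellP.2 (slot_sub fzg).
have anchorP g : exists2 a, ~~ Z a & anchor g = cell a.
  rewrite /anchor; case: ifPn => [/fP[a [Za _ -> _]]|Zg]; first by exists a.
  by exists g.
have D_sym g : g \in D -> (g^-1)%g \in D.
  move=> /fmulP[v [w [vW wW ->]]]; by rewrite invgM mem_fmul ?mem_finv // -finvE.
pose D' := fmul D M.
(* The restriction to [fmul D' A] keeps this set finite; by [anchorZ] no matched point is lost. *)
pose extra (A : {fset G}) := [fset z in fmul D' A | Z z && (f z \in A)]%fset.
pose cell' g := (anchor g `|` extra (anchor g))%fset.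
have anchorZ g : Z g -> g \in extra (anchor g).
  move=> Zg; rewrite /anchor Zg in_fset_filter Zg cellP.1 !andbT.
  have [a [Za aD fgE fg]] := fP _ Zg.
  apply/fmulP; exists ((a * g^-1)^-1 * (a * (f g)^-1))%g, (f g); split.
  - by apply: mem_fmul; [exact: D_sym|apply: cellM; rewrite fgE; exact: cellP.1].
  - exact: cellP.1.
  - by rewrite invgM invgK -!mulgA mulKg mulVg mulg1.
have cell'E g h : (h \in cell' g) = (anchor h == anchor g).
  apply/idP/eqP => [|hg]; last first.
    rewrite /cell' -hg in_fsetU; have [Zh|Zh] := boolP (Z h); first by rewrite anchorZ ?orbT.
    by rewrite /anchor (negbTE Zh) cellP.1.
  have [a Za ga] := anchorP g; rewrite /cell' ga in_fsetU => /orP[ha|].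
    by rewrite /anchor (cellZ ha) (negbTE Za) (cellP.2 _ _ ha).
  by rewrite in_fset_filter => /and3P[_ Zh fha]; rewrite /anchor Zh (cellP.2 _ _ fha).
exists cell'; exists (fmul (fmul (1%g |` D') M) (finv (fmul (1%g |` D') M)))%fset; split.
- split=> [g|g h]; rewrite cell'E // => /eqP hg.
  by rewrite /cell' hg.
- have near a h : h \in (cell a `|` extra (cell a))%fset -> (h * a^-1)%g \in fmul (1%g |`
    D')%fset M.
    rewrite in_fsetU in_fset_filter => /orP[ha|/andP[/fmulP[u [x [uD' xa ->]]] _]].
      by rewrite -[X in X \in _]mul1g mem_fmul ?cellM // fset1U1.
    by rewrite -mulgA mem_fmul ?cellM // fset1Ur.
  move=> g h; rewrite cell'E => /eqP hg; have [a Za ga] := anchorP g.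
  have : h \in cell' g by rewrite cell'E hg.
  have : g \in cell' g by rewrite cell'E.
  rewrite /cell' ga => /near ga' /near ha.
  rewrite -(mulgVK a h) -mulgA -(invgK (a * g^-1)%g) invgM invgK mem_fmul //.
  by rewrite mem_finv.
- move=> g; have [a Za ga] := anchorP g; rewrite /cell' ga.
  have extra_le : (q * #|` extra (cell a)| <= #|` cell a|)%N.
    rewrite mulnC; apply: leq_trans (leq_divM _ q); rewrite leq_mul2r -card_slot.
    apply/orP; right; apply: (@leq_card_inj _ _ f) => [u v|z].
      by rewrite !in_fset_filter => /and3P[_ Zu _] /and3P[_ Zv _]; exact: finj.
    rewrite in_fset_filter => /and3P[_ /fP[b [_ _ fzb fzs]] fza].
    by rewrite -(cellP.2 _ _ fza) fzb.
  have bdry : (#|` boundary S (cell a `|` extra (cell a))%fset| <=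
      #|` boundary S (cell a)| + #|` extra (cell a)|)%N.
    apply: leq_trans (leq_card_fsetU _ _); apply: fsubset_card => h /boundaryP[].
    rewrite !in_fsetU => /orP[ha|->] [s sS sh]; last by rewrite orbT.
    apply/orP; left; apply/boundaryP; split=> //; exists s => //.
    by apply: contra sh => sha; rewrite in_fsetU sha.
  apply: leq_trans (leq_mul (leqnn q) bdry) _; rewrite mulnDr mul2n -addnn.
  apply: leq_trans (leq_add (cell_folner Za) extra_le) _.
  by rewrite leq_add // fsubset_leq_card // fsubsetUl.
Qed.

End Redistribution.

Lemma boundary_ratio_ge0 (R : realType) (G : groupType) (S F : {fset G}) :
  0 <= boundary_ratio S F :> R.
Proof. by rewrite divr_ge0. Qed.

Lemma max_ratio_ge0 (R : realType) (G : groupType) (S : {fset G}) m (F : 'I_m -> {fset G}) :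
  0 <= max_ratio R S F.
Proof. exact: bigmax_ge_id. Qed.

Lemma le_max_ratio (R : realType) (G : groupType) (S : {fset G}) m (F : 'I_m -> {fset G}) i :
  boundary_ratio S (F i) <= max_ratio R S F.
Proof. exact: le_bigmax. Qed.

(** * Foelner sequences of multi-tiles *)

Section Existence.
Context {R : realType} {G : groupType} (S : {fset G}).
Hypotheses (S_sym : symmetric_fset S) (S_gen : generates S)
  (G_inf : infinite_set [set: G]) (G_amen : amenable_group R G).

Definition has_multi_tile (n : nat) (e : R) (mF : {m & 'I_m -> {fset G}}) :=
  [/\ multi_tile (tagged mF), forall i, (#|` tagged mF i| <= n)%N &
      max_ratio R S (tagged mF) <= e].

Lemma multi_tile_ratio (q : nat) : exists n mF, has_multi_tile n (2 / q.+1%:R) mF.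
Proof.
have [cell [M [W [Z [cellP cellM cellZ cellG [W0 WZ]]]]]] :=
  quasi_tiling S_sym S_gen G_inf G_amen (ltn0Sn q).
have [cell' [M' [cellP' cellM' cellG']]] := folner_partition (ltn0Sn q) cellP cellM cellZ
  (fun g Zg => (cellG g Zg).1) (fun g Zg => (cellG g Zg).2) W0 WZ.
have [|g|m [F [tF FM Fe]]] := @multi_tile_of_cells G R S cell' M' (2 / q.+1%:R) cellP' _ cellM'.
- by rewrite divr_ge0.
- have g0 : (0 < #|` cell' g|)%N by rewrite cardfs_gt0; apply/fset0Pn; exists g; exact: cellP'.1.
  rewrite /boundary_ratio ler_pdivrMr ?ltr0n // mulrAC ler_pdivlMr ?ltr0n //.
  by rewrite mulrC -!natrM ler_nat.
by exists #|` M'|, (existT _ m F).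
Qed.

(** The bound 2 is the case [q = 0] of [2 / q.+1], so every positive [n] has at least one admissible
    [q]. *)
Lemma multi_tile_singletons n : (0 < n)%N -> exists mF, has_multi_tile n 2 mF.
Proof.
move=> n0.
have [|||g|m [F [tF FM Fe]]] := @multi_tile_of_cells G R S (fun g => [fset g]%fset) [fset
    1%g]%fset 2.
- by split=> [g|g h]; rewrite inE // => /eqP ->.
- by [].
- by move=> g h; rewrite inE => /eqP ->; rewrite mulgV inE.
- rewrite /boundary_ratio cardfs1 divr1; apply: (@le_trans _ _ 1); last by rewrite ler1n.
  by rewrite -[1]/(1%:R) ler_nat -(cardfs1 g); exact: card_boundary_le.
exists (existT _ m F); split=> // i; apply: leq_trans (FM i) _; by rewrite cardfs1.
Qed.

Lemma folner_multi_tiles_exist :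
  exists (N : nat -> nat) (T : forall n, 'I_(N n) -> {fset G}), folner_multi_tiles R S N T.
Proof.
(* For each [n] the largest admissible [q] is taken; [q <= n] makes the maximum exist. Every fixed
   [q] is eventually admissible, hence the convergence. *)
pose P n q := (q <= n)%N /\ exists mF, has_multi_tile n (2 / q.+1%:R) mF.
have /choice[f fP] n : exists mF : {m & 'I_m -> {fset G}}, (0 < n)%N ->
    [/\ multi_tile (tagged mF), forall i, (#|` tagged mF i| <= n)%N &
      forall q, P n q -> max_ratio R S (tagged mF) <= 2 / q.+1%:R].
  have [->|n0] := posnP n; first by exists (existT _ 0%N (fun=> fset0)).
  have Pn : exists q, `[< P n q >].
    exists 0%N; apply/asboolP; split=> //.
    by have [mF] := multi_tile_singletons n0; exists mF; rewrite divr1.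
  have Pb q : `[< P n q >] -> (q <= n)%N by move=> /asboolP[].
  case: (ex_maxnP Pn Pb) => q /asboolP[qn [mF [tF Fn Fe]]] qmax.
  exists mF => _; split=> // q' Pq'; apply: le_trans Fe _.
  rewrite ler_pM2l // lef_pV2 ?posrE ?ltr0n // ler_nat ltnS.
  by apply: qmax; apply/asboolP.
exists (fun n => tag (f n)), (fun n => tagged (f n)); split.
  by move=> n /fP[].
apply/cvgrPdist_le => e e0.
have [q qe] : exists q, 2 / q.+1%:R <= e.
  exists (Num.truncn (2 / e)); rewrite ler_pdivrMr ?ltr0n // mulrC -ler_pdivrMr //.
  exact/ltW/truncnS_gt.
have [n0 [mF [tF Fn Fe]]] := multi_tile_ratio q.
exists (maxn n0 q).+1 => // n /= nn.
have n_gt0 : (0 < n)%N by apply: leq_trans nn.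
rewrite sub0r normrN ger0_norm ?max_ratio_ge0 //; apply: le_trans qe.
have [_ _] := fP n n_gt0; apply; split.
  by apply: leq_trans (ltnW nn); exact: leq_maxr.
exists mF; split=> // i; apply: leq_trans (Fn i) (leq_trans _ (ltnW nn)).
exact: leq_maxl.
Qed.
End Existence.

(** * Measure-theoretic preliminaries *)

Section FiniteMeasure.
Context {R : realType} {d : measure_display} {X : measurableType d} (mu : probability X R).
Implicit Types (A B C : set X).
Local Notation m A := (fine (mu A)).

Lemma fine_mu_ge0 A : 0 <= m A.
Proof. exact/fine_ge0. Qed.

Lemma fine_mu_le A B : measurable A -> measurable B -> A `<=` B -> m A <= m B.
Proof.
by move=> mA mB AB; rewrite fine_le ?fin_num_measure //; apply: le_measure; rewrite ?inE.
Qed.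

Lemma fine_mu_le1 A : measurable A -> m A <= 1.
Proof. by move=> mA; rewrite -lee_fin fineK ?fin_num_measure // probability_le1. Qed.

Lemma integral_indic_sum (I : Type) (r : seq I) (A : I -> set X) (a : R) :
  0 <= a -> (forall i, measurable (A i)) ->
  (\int[mu]_x (a * \sum_(i <- r) \1_(A i) x)%:E = (a * \sum_(i <- r) m (A i))%:E)%E.
Proof.
move=> a0 mA; under eq_integral do rewrite EFinM -sumEFin.
rewrite ge0_integralZl_EFin //; last 2 first.
- by move=> x _; apply: sume_ge0 => i _; rewrite lee_fin.
- by apply: emeasurable_sum => i; apply/measurable_EFinP/measurable_indic.
rewrite ge0_integral_sum //; last first.
  by move=> i; apply/measurable_EFinP/measurable_indic.
rewrite EFinM -sumEFin; congr (_ * _)%E; apply: eq_bigr => i _.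
by rewrite integral_indic // setIT fineK ?fin_num_measure.
Qed.

(** Integrates a pointwise count. Combined with invariance, it turns counting in single tiles or
    classes into inequalities between measures. *)
Lemma indic_sum_le (I J : Type) (r : seq I) (s : seq J) (A : I -> set X)
    (B : J -> set X) (a b : R) : 0 <= a -> 0 <= b ->
  (forall i, measurable (A i)) -> (forall j, measurable (B j)) ->
  {ae mu, forall x, a * \sum_(i <- r) \1_(A i) x <= b * \sum_(j <- s) \1_(B j) x} ->
  a * \sum_(i <- r) m (A i) <= b * \sum_(j <- s) m (B j).
Proof.
move=> a0 b0 mA mB AB; rewrite -lee_fin -!integral_indic_sum //.
apply: ae_ge0_le_integral => //.
- by move=> x _; rewrite lee_fin mulr_ge0 ?sumr_ge0.
- apply/measurable_EFinP/measurable_funM => //.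
  by apply: measurable_sum => i; exact: measurable_indic.
- by move=> x _; rewrite lee_fin mulr_ge0 ?sumr_ge0.
- apply/measurable_EFinP/measurable_funM => //.
  by apply: measurable_sum => i; exact: measurable_indic.
by apply: filterS AB => x AB _; rewrite lee_fin.
Qed.

Lemma fine_mu_bigcup_le (F : nat -> set X) (b : R) : (forall n, measurable (F n)) ->
  (forall k n, (k <= n)%N -> F k `<=` F n) -> (forall n, m (F n) <= b) ->
  m (\bigcup_n F n) <= b.
Proof.
move=> mF Fnd Fb; have mUF : measurable (\bigcup_n F n) by exact: bigcupT_measurable.
rewrite -lee_fin fineK ?fin_num_measure //.
apply: (cvge_to_le (nondecreasing_cvg_mu mF mUF _)).
  by move=> k n kn; apply/subsetPset; exact: Fnd.
by apply: nearW => n /=; rewrite -[leLHS]fineK ?fin_num_measure // lee_fin Fb.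
Qed.

Lemma fine_mu_cover (J : Type) (s : seq J) A (B : J -> set X) : measurable A ->
  (forall j, measurable (B j)) ->
  (forall x, A x -> has (fun j => `[< B j x >]) s) -> m A <= \sum_(j <- s) m (B j).
Proof.
move=> mA mB AB.
have := @indic_sum_le unit J [:: tt] s (fun=> A) B 1 1 ler01 ler01 (fun=> mA) mB.
rewrite !big_seq1 !mul1r; apply; apply: aeW => x; rewrite !mul1r big_seq1.
rewrite indicE; case: (boolP (x \in A)) => [|_]; last exact: sumr_ge0.
rewrite inE => /AB; elim: s {AB} => [//|j s IH] /=; rewrite big_cons => /orP[/asboolP Bx|/IH {}IH].
  by rewrite indicE (mem_set Bx) lerDl sumr_ge0.
by apply: le_trans IH _; rewrite lerDr.
Qed.

Lemma sum_indic_card (T : choiceType) (V : {fset T}) (A : T -> set X) x :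
  \sum_(v <- V) \1_(A v) x = #|` [fset v in V | `[< A v x >]]%fset|%:R :> R.
Proof.
rewrite card_fset_filter natr_sum; apply: eq_bigr => v _; rewrite indicE.
by congr (nat_of_bool _)%:R; apply/idP/asboolP; rewrite inE.
Qed.

End FiniteMeasure.

Section StandardBorel.
Context {R : realType} {d : measure_display} {X : measurableType d}.

(** A countable base pulled back to [X] and numbered by an injection into [nat]; numbers that code
    no base set give the empty set. *)
Lemma separating_sets : standard_borel R X ->
  exists2 U : nat -> set X, forall i, measurable (U i) &
    forall x y, x <> y -> exists i, U i x /\ ~ U i y.
Proof.
move=> [Y [f [Yh [B /countable_injP[c cinj] [Bopen Bbasis]] fbij fmeas]]].
pose U i := [set x | exists2 W, B W /\ c W = i & W (f x)].
have UE W : B W -> U (c W) = f @^-1` W.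
  move=> BO; apply/seteqP; split=> x /=; last by move=> Ox; exists W.
  by move=> [W' [BW' cO]]; rewrite (cinj W' W) ?inE.
exists U => [i|x y xy].
  have [[W BO <-]|noO] := pselect (exists2 W, B W & c W = i).
    rewrite UE //; apply/fmeas; rewrite image_preimage; last first.
      by apply/seteqP; split=> // y _; have [g _ fg] := fbij; exists (g y); rewrite ?fg.
    by apply: sub_sigma_algebra; exact: Bopen.
  rewrite (_ : U i = set0) //; apply/seteqP; split=> // x [W [BO cO] _].
  by apply: noO; exists W.
have fxy : f x != f y by apply/eqP => /(bij_inj fbij).
have := Yh; rewrite open_hausdorff => /(_ _ _ fxy)[[P Q] /= [xP yQ] [oP oQ /eqP PQ]].
have [W [BO Ox] OP] : filter_from [set U | B U /\ U (f x)] id P.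
  by apply: (Bbasis (f x)); apply: open_nbhs_nbhs; split=> //; rewrite inE in xP.
exists (c W); rewrite UE //; split=> //= Oy.
have : (P `&` Q) (f y) by split; [exact: OP|rewrite inE in yQ].
by rewrite PQ.
Qed.

Lemma measurable_diagonal (U : nat -> set X) : (forall i, measurable (U i)) ->
  (forall x y, x <> y -> exists i, U i x /\ ~ U i y) ->
  measurable [set xy : X * X | xy.1 = xy.2].
Proof.
move=> mU sepU.
rewrite (_ : [set _ | _] = ~` \bigcup_i (U i `*` ~` U i)).
  apply/measurableC/bigcupT_measurable => i.
  by apply: measurableX => //; exact: measurableC.
apply/seteqP; split=> -[x y] /=; first by move=> -> [i _ /= []].
by move=> nU; apply: contrapT => xy; have [i Ui] := sepU _ _ xy; apply: nU; exists i.
Qed.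

End StandardBorel.

(** * Greedy towers in a measure preserving action *)

Section MeasuredGreedy.
Context {R : realType} {G : groupType} {d : measure_display} {X : measurableType d}
  (mu : probability X R) (a : G -> X -> X).
Hypothesis a_pmp : pmp_action mu a.
Local Notation m A := (fine (mu A)).

Let a1 x : a 1%g x = x. Proof. by case: a_pmp. Qed.
Let aM g h x : a (g * h)%g x = a g (a h x). Proof. by case: a_pmp. Qed.

Lemma act_invK g x : a (g^-1)%g (a g x) = x.
Proof. by rewrite -aM mulVg a1. Qed.

Lemma act_Kinv g x : a g (a (g^-1)%g x) = x.
Proof. by rewrite -aM mulgV a1. Qed.

Lemma measurable_act g (A : set X) : measurable A -> measurable (a g @^-1` A).
Proof. by move=> mA; rewrite -[X in measurable X]setTI; case: a_pmp => _ _ am _; exact: am. Qed.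

Lemma fine_mu_act g (A : set X) : measurable A -> m (a g @^-1` A) = m A.
Proof. by move=> mA; case: a_pmp => _ _ _ ->. Qed.

Lemma measurable_fset_all (T : choiceType) (V : {fset T}) (A : T -> set X) :
  (forall v, measurable (A v)) -> measurable [set x | forall v, v \in V -> A v x].
Proof.
move=> mA; rewrite (_ : [set _ | _] = \bigcap_(v in [set` V]) A v) //.
exact: fin_bigcap_measurable.
Qed.

Lemma measurable_fset_has (T : choiceType) (V : {fset T}) (A : T -> set X) :
  (forall v, measurable (A v)) -> measurable [set x | exists2 v, v \in V & A v x].
Proof.
move=> mA; rewrite (_ : [set _ | _] = \bigcup_(v in [set` V]) A v) //.
exact: fin_bigcup_measurable.
Qed.

Section Tower.
Variables (V : {fset G}) (B : nat -> set X) (t : nat).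
Hypothesis mB : forall k, measurable (B k).

Lemma measurable_pattern_card (Y : set X) (n : nat) : measurable Y ->
  measurable [set x | (n <= #|` pattern a V Y x|)%N].
Proof.
move=> mY; rewrite (_ : [set _ | _] = [set x | exists2 P, P \in
    [fset P in fpowerset V | (n <= #|` P|)%N]%fset & forall v, v \in P -> Y (a v x)]).
  by apply: measurable_fset_has => P; apply: measurable_fset_all => v; exact: measurable_act.
apply/seteqP; split=> x /=.
  move=> nx; exists (pattern a V Y x); last by move=> v /patternP[].
  rewrite in_fset_filter fpowersetE nx andbT; apply/fsubsetP => v /patternP[] //.
move=> [P]; rewrite in_fset_filter fpowersetE => /andP[/fsubsetP PV nP] PY.
apply: leq_trans nP _; apply: fsubset_card => v vP; apply/patternP; split; auto.
Qed.

Lemma measurable_base Y k : measurable Y -> measurable (base a V B t Y k).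
Proof.
move=> mY; rewrite (_ : base a V B t Y k = B k `&` [set x | (t <= #|` pattern a V Y x|)%N]) //.
by apply: measurableI => //; exact: measurable_pattern_card.
Qed.

Lemma measurable_rest k : measurable (rest a V B t k).
Proof.
elim: k => [|k IH] /=; first exact: measurableT.
apply: measurableI => //; apply: measurableC.
rewrite (_ : [set _ | _] = [set y | exists2 v, v \in V &
    (a (v^-1)%g @^-1` base a V B t (rest a V B t k) k) y]).
  by apply: measurable_fset_has => v; apply: measurable_act; exact: measurable_base.
apply/seteqP; split=> y /=; first by move=> [x bx [v vV <-]]; exists v; rewrite ?act_invK.
by move=> [v vV bx]; exists (a (v^-1)%g y) => //; exists v; rewrite ?act_Kinv.
Qed.

Lemma measurable_leftover : measurable (leftover a V B t).
Proof. by apply: bigcapT_measurable => k; exact: measurable_rest. Qed.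

(** By invariance the left side is the integral of the number of [v] in [V] that send [x] into the
    leftover. Almost every [x] is a candidate centre at some stage, so this number is below [t]. *)
Lemma fine_mu_leftover (N : set X) : mu.-negligible N -> (0 < t)%N ->
  (forall x, ~ N x -> exists k, B k x) ->
  #|` V|%:R * m (leftover a V B t) <= t.-1%:R.
Proof.
move=> N0 t0 NB; pose L := leftover a V B t.
have mL : measurable L := measurable_leftover.
have -> : #|` V|%:R * m L = 1 * \sum_(v <- V) m (a v @^-1` L).
  under eq_bigr do rewrite fine_mu_act //.
  by rewrite big_const_seq count_predT iter_addr_0 mul1r mulr_natl.
have -> : t.-1%:R = t.-1%:R * \sum_(i <- [:: tt]) m [set: X].
  by rewrite big_seq1 probability_setT mulr1.
apply: indic_sum_le => //.
- by move=> v; exact: measurable_act.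
apply: negligibleS N0 => x /= nh; apply: contrapT => /NB[k kx]; apply: nh.
  rewrite mul1r big_seq1 indicT mulr1 sum_indic_card ler_nat -ltnS prednK //.
  exact: (@leftover_count G X a V B t k x t0 kx).
Qed.

Hypothesis B_sep : forall k x y v w, B k x -> B k y -> v \in V -> w \in V ->
  a v x = a w y -> x = y /\ v = w.

Let C k := base a V B t (rest a V B t k) k.

(** A point removed at stage [k] has exactly one position [v]; moving it back to its centre by the
    inverse of [v] preserves measure. *)
Lemma fine_mu_tile (Q : set X) k : measurable Q ->
  m (Q `&` (rest a V B t k `\` rest a V B t k.+1)) =
  \sum_(v <- V) m (C k `&` a v @^-1` (Q `&` rest a V B t k)).
Proof.
move=> mQ; have mR := measurable_rest.
pose A v := a (v^-1)%g @^-1` (C k `&` a v @^-1` (Q `&` rest a V B t k)).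
have mC v : measurable (C k `&` a v @^-1` (Q `&` rest a V B t k)).
  by apply: measurableI; [exact: measurable_base|apply/measurable_act/measurableI].
have mA v : measurable (A v) by exact: measurable_act.
have mP : measurable (Q `&` (rest a V B t k `\` rest a V B t k.+1)).
  by apply: measurableI => //; exact: measurableD.
have AE x : \sum_(v <- V) \1_(A v) x =
    \sum_(i <- [:: tt]) \1_(Q `&` (rest a V B t k `\` rest a V B t k.+1)) x :> R.
  rewrite big_seq1 sum_indic_card indicE.
  have AP v : v \in V -> A v x -> tile_at a V B t k v (a (v^-1)%g x) x /\ Q x.
    by rewrite /A /= act_Kinv => vV [Cx [Qx Rx]]; split=> //; split; rewrite ?act_Kinv.
  case: (boolP (x \in _)) => [|xP].
    rewrite inE => -[Qx [xk nxk]]; have [v [x' hx]] := tile_atP xk nxk.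
    rewrite (_ : [fset _ in _ | _]%fset = [fset v]%fset) ?cardfs1 //.
    apply/fsetP => w; rewrite in_fset_filter inE;
        apply/andP/eqP => [[wV /asboolP/(AP _ wV)[hw _]]|->].
      by have [] := tile_at_inj B_sep hw hx.
    case: hx => bx vV vx _; split=> //; apply/asboolP.
    by rewrite /A /= -vx act_invK vx.
  rewrite (_ : [fset _ in _ | _]%fset = fset0) ?cardfs0 //.
  apply/fsetP => w; rewrite in_fset_filter in_fset0;
      apply/negP => /andP[wV /asboolP/(AP _ wV)[hw Qx]].
  move/negP: xP; apply; rewrite inE; split=> //; split; last exact: rest_tile_at hw.
  by case: hw.
transitivity (\sum_(v <- V) m (A v)); last by apply: eq_bigr => v _; rewrite fine_mu_act.
apply/le_anti/andP; split.
  have := @indic_sum_le R d X mu unit G [:: tt] V (fun=> _) A 1 1 ler01 ler01 (fun=> mP) mA.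
  by rewrite big_seq1 !mul1r; apply; apply: aeW => x; rewrite AE.
have := @indic_sum_le R d X mu G unit V [:: tt] A (fun=> _) 1 1 ler01 ler01 mA (fun=> mP).
by rewrite big_seq1 !mul1r; apply; apply: aeW => x; rewrite AE.
Qed.

(** Measured analogue of the cellwise count: integrate over the centres of each stage, add the
    stages, pass to the limit by continuity from below. The limit is taken after dividing by [al],
    so [al = 0] is treated apart. *)
Lemma fine_mu_tiles (Q : set X) (al be : R) : measurable Q -> 0 <= al -> 0 <= be ->
  (forall k x, C k x -> al * #|` pattern a V (Q `&` rest a V B t k) x|%:R <=
                        be * #|` pattern a V (rest a V B t k) x|%:R) ->
  al * m (Q `\` leftover a V B t) <= be.
Proof.
move=> mQ al0 be0 h; have mR := measurable_rest.
have mCk v (Q' : set X) k : measurable Q' -> measurable (C k `&` a v @^-1` (Q' `&` rest a V B t k)).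
  by move=> mQ'; apply: measurableI; [exact: measurable_base|apply/measurable_act/measurableI].
pose P k := rest a V B t k `\` rest a V B t k.+1.
have hk k : al * m (Q `&` P k) <= be * m (P k).
  have -> : m (P k) = m (setT `&` P k) by rewrite setTI.
  rewrite !fine_mu_tile //; apply: indic_sum_le => // [v|v|]; try exact: mCk.
  apply: aeW => x; rewrite !sum_indic_card.
  have [Cx|nCx] := pselect (C k x); last first.
    have e0 (Q' : set X) : [fset v in V | `[< (C k `&` a v @^-1` (Q' `&` rest a V B t k))%classic
        x >]]%fset = fset0.
      by apply/fsetP => v; rewrite in_fset_filter in_fset0; apply/negP => /andP[_ /asboolP[]].
    by rewrite !e0 !mulr0.
  have patE (Q' : set X) : [fset v in V | `[< (C k `&` a v @^-1` (Q' `&` rest a V B t k))%classic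
      x >]]%fset =
      pattern a V (Q' `&` rest a V B t k) x.
    apply/fsetP => v; rewrite !in_fset_filter; congr (_ && _).
    by apply/asboolP/asboolP => [[]|].
  by rewrite !patE setTI; exact: h.
have hn n : al * m (Q `\` rest a V B t n) <= be * m (~` rest a V B t n).
  elim: n => [|n IH]; first by rewrite /= setDT setCT !measure0 !mulr0.
  have split_rest (Q' : set X) : measurable Q' -> m (Q' `\` rest a V B t n.+1) =
      m (Q' `\` rest a V B t n) + m (Q' `&` P n).
    move=> mQ'; rewrite -fineD ?fin_num_measure //; last 2 first.
    - exact: measurableD.
    - by apply: measurableI => //; exact: measurableD.
    rewrite -measureU //; last 3 first.
    - exact: measurableD.
    - by apply: measurableI => //; exact: measurableD.
    - by apply/seteqP; split=> // x [[_ nx] [_ [xn _]]].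
    congr (fine (mu _)); apply/seteqP; split=> x.
      move=> [Qx nx]; have [xn|xn] := pselect (rest a V B t n x); last by left.
      by right.
    move=> [[Qx nx]|[Qx [_ nx]]]; split=> // xn; apply: nx.
    exact: rest_anti (leqnSn n) _ xn.
  have /= := split_rest setT measurableT; rewrite !setTD setTI => ->.
  by rewrite split_rest // !mulrDr lerD.
have [->|al_neq0] := eqVneq al 0; first by rewrite mul0r.
have al_gt0 : 0 < al by rewrite lt0r al_neq0.
rewrite mulrC -ler_pdivlMr //.
rewrite /leftover setDE setC_bigcap setI_bigcupr; apply: fine_mu_bigcup_le.
- by move=> n; rewrite -setDE; exact: measurableD.
- by move=> k n kn; apply: setIS; apply: subsetC; exact: rest_anti.
- move=> n; rewrite -setDE ler_pdivlMr // mulrC; apply: le_trans (hn n) _.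
  by rewrite ler_piMr // fine_mu_le1 //; exact: measurableC.
Qed.

End Tower.
End MeasuredGreedy.

Lemma card_le_fset (T : choiceType) U (A : {fset T}) (f : T -> U) (B : set U) n :
  (#|` A| <= n)%N -> B `<=` f @` [set` A] -> (B #<= `I_n)%card.
Proof.
move=> An BA; have [A0|/fset0Pn[x0 _]] := eqVneq A fset0.
  have -> : B = set0 by apply/seteqP; split=> // y /BA[x /=]; rewrite A0.
  exact: card_ge0.
apply: card_le_trans (card_image_le (fun i => f (nth x0 A i)) `I_n).
apply: subset_card_le => y /BA[x /= xA <-]; exists (index x A) => /=; last by rewrite nth_index.
by apply: leq_trans An; rewrite index_mem.
Qed.

(** * Countable covers by separated sets in a free action *)

Section Cover.
Context {R : realType} {G : groupType} {d : measure_display} {X : measurableType d}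
  (mu : probability X R) (a : G -> X -> X).
Hypotheses (a_pmp : pmp_action mu a) (a_free : free_action mu a)
  (X_borel : standard_borel R X).

(** At a free point [x], each [g] in [M] moves [x] out of some [U i] containing it. A finite list of
    indices records this for all [g], there are countably many lists, and stage [k] takes the points
    for which the list coded by [k] works. If [x] and [g x] were both taken, [g x] would be inside
    and outside the same [U i]. *)
Lemma free_cover (V : {fset G}) : exists (B : nat -> set X) (N : set X),
  [/\ forall k, measurable (B k), mu.-negligible N,
      forall x, ~ N x -> exists k, B k x &
      forall k x y v w, B k x -> B k y -> v \in V -> w \in V ->
        a v x = a w y -> x = y /\ v = w].
Proof.
have [U mU sepU] := separating_sets X_borel.
pose M := [fset g in fmul (finv V) V | g != 1%g]%fset.
pose s k g := nth 0%N (odflt [::] (choice.unpickle k)) (index g M).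
exists (fun k => [set x | forall g, g \in M -> (U (s k g) `&` ~` (a g @^-1` U (s k g))) x]).
exists (~` [set x | forall g, a g x = x -> g = 1%g]); split=> //.
- move=> k; apply: measurable_fset_all => g; apply: measurableI => //.
  by apply/measurableC/(measurable_act a_pmp).
- move=> x /= /contrapT x_free.
  have /choice[i iP] g : exists i, g \in M -> U i x /\ ~ U i (a g x).
    have [gM|] := boolP (g \in M); last by exists 0%N.
    have [|i Ui] := sepU x (a g x); last by exists i.
    move=> /esym/x_free g1; move: gM; rewrite in_fset_filter g1 eqxx.
    by rewrite andbF.
  exists (choice.pickle [seq i g | g <- M]) => g gM.
  have -> : s (choice.pickle [seq i g | g <- M]) g = i g; last exact: iP.
  by rewrite /s choice.pickleK /= (nth_map 1%g) ?index_mem // nth_index.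
- move=> k x y v w /= Bx By vV wV vxwy.
  have yE : y = a (w^-1 * v)%g x.
    by case: a_pmp => a1 aM _ _; rewrite aM vxwy -aM mulVg a1.
  have [wv|wv] := eqVneq (w^-1 * v)%g 1%g.
    move: yE; rewrite wv; case: (a_pmp) => -> _ _ _ ->; split=> //.
    by rewrite -[v](mulVKg w) wv mulg1.
  have gM : (w^-1 * v)%g \in M by rewrite in_fset_filter mem_fmul ?mem_finv.
  by have [_ /=] := Bx _ gM; have [] := By _ gM; rewrite -yE.
Qed.

End Cover.

(** * The subrelation obtained by copying a partition of the group into a tower *)

Section Relation.
Context {R : realType} {G : groupType} {d : measure_display} {X : measurableType d}
  (mu : probability X R) (a : G -> X -> X).
Hypotheses (a_pmp : pmp_action mu a) (mdiag : measurable [set xy : X * X | xy.1 = xy.2]).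
Local Notation m A := (fine (mu A)).

Let a1 x : a 1%g x = x. Proof. by case: a_pmp. Qed.
Let aM g h x : a (g * h)%g x = a g (a h x). Proof. by case: a_pmp. Qed.

Lemma measurable_rel_boundary (S : {fset G}) (theta : set (X * X)) :
  measurable theta -> measurable (rel_boundary S a theta).
Proof.
move=> mtheta; apply: measurable_fset_has => s.
rewrite [X in measurable X](_ : _ = ~` ((fun x => (x, a s x)) @^-1` theta)).
  apply: measurableC; rewrite -[X in measurable X]setTI.
  apply: (measurable_fun_pair _ _ measurableT) => //.
  by case: a_pmp => _ _ am _; exact: am.
by apply/seteqP; split=> x /=; rewrite /xsection /= inE.
Qed.

Variables (V : {fset G}) (B : nat -> set X) (t : nat).
Hypotheses (mB : forall k, measurable (B k))
  (B_sep : forall k x y v w, B k x -> B k y -> v \in V -> w \in V ->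
    a v x = a w y -> x = y /\ v = w).
Variables (cell : G -> {fset G}) (n : nat).
Hypotheses (n0 : (0 < n)%N) (cellP : cell_partition cell)
  (cell_le : forall g, (#|` cell g| <= n)%N).

Let Y := rest a V B t.
Let C k := base a V B t (Y k) k.
Let tile := tile_at a V B t.
Let whole k v x := (cell v `<=` pattern a V (Y k) x)%fset.

(** The partition of [G] is copied into each tile through positions. A cell that is not wholly
    available in the tile is broken into singletons, whose points are charged to the edge. *)
Definition cell_rel : set (X * X) := [set yz | yz.1 = yz.2 \/
  exists k v x, [/\ tile k v x yz.1, whole k v x & exists2 w, w \in cell v & a w x = yz.2]].

Let tile_inj k v x k' v' x' y : tile k v x y -> tile k' v' x' y ->
  [/\ k = k', v = v' & x = x'].
Proof. by move=> h h'; exact: (tile_at_inj B_sep h h'). Qed.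

Let whole_tile k v x y w : tile k v x y -> whole k v x -> w \in cell v ->
  tile k w x (a w x) /\ whole k w x.
Proof.
move=> h wh wv; split; last by rewrite /whole (cellP.2 _ _ wv).
by apply: tile_at_pattern h _; exact: (fsubsetP wh).
Qed.

Lemma measurable_whole k v :
  measurable [set y | exists x, tile k v x y /\ whole k v x].
Proof.
have [vV|vV] := boolP (v \in V); last first.
  rewrite (_ : [set _ | _] = set0) //; apply/seteqP; split=> // y [x [[_ vV']]].
  by rewrite vV' in vV.
have mY k' : measurable (Y k') by exact: (measurable_rest a_pmp).
rewrite (_ : [set _ | _] = Y k `&` a (v^-1)%g @^-1` (C k `&`
    [set x | forall w, w \in cell v -> ([set x | w \in V] `&` a w @^-1` Y k) x])).
  apply: measurableI; first exact: mY.
  apply: (measurable_act a_pmp); apply: measurableI; first exact: (measurable_base a_pmp).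
  apply: measurable_fset_all => w; apply: measurableI; last exact: (measurable_act a_pmp).
  by case: (w \in V); [rewrite (_ : [set _ | _] = setT)|rewrite (_ : [set _ | _] = set0)] => //;
    apply/seteqP; split.
apply/seteqP; split=> y /=.
  move=> [x [[Cx _ <- yk] /fsubsetP wh]]; rewrite (act_invK a_pmp); split=> //; split=> // w /wh.
  by move=> /patternP[].
move=> [yk [Cx wh]]; exists (a (v^-1)%g y); split; first by split; rewrite ?(act_Kinv a_pmp).
by apply/fsubsetP => w /wh[wV wY]; apply/patternP.
Qed.

Lemma measurable_cell_rel : measurable cell_rel.
Proof.
(* For fixed [k], [v], [w], the relation says that [z] is the image of [y] under [w v^-1]: a
   preimage of the diagonal under a measurable map. *)
rewrite (_ : cell_rel = [set yz | yz.1 = yz.2] `|` \bigcup_k [set yz | exists2 v, v \in V &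
  [set yz | exists2 w, w \in cell v & ([set y | exists x, tile k v x y /\ whole k v x] `*` setT `&`
     (fun yz => (a w (a (v^-1)%g yz.1), yz.2)) @^-1` [set xy : X * X | xy.1 = xy.2]) yz] yz]).
  apply: measurableU => //; apply: bigcupT_measurable => k.
  apply: measurable_fset_has => v; apply: measurable_fset_has => w; apply: measurableI.
    by apply: measurableX => //; exact: measurable_whole.
  rewrite -[X in measurable X]setTI; apply: (measurable_fun_pair _ _ measurableT) => //.
  have ma g : measurable_fun setT (a g) by case: a_pmp.
  by apply: (measurableT_comp (ma w)); apply: (measurableT_comp (ma _)); exact: measurable_fst.
apply/seteqP; split=> -[y z] /=.
  move=> [/= ->|[k [v [x [/= h wh [w wv <-]]]]]]; [by left|right; exists k => //; exists v;
      first by case: h].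
  exists w => //; split; first by split=> //; exists x.
  by case: h => _ _ <- _; rewrite (act_invK a_pmp).
move=> [/= ->|[k _ [v vV [w wv [[[x [h wh]] _] /= wz]]]]]; [by left|right; exists k, v, x;
    split=> //].
exists w => //; rewrite -wz; case: h => _ _ /= <- _.
by rewrite (act_invK a_pmp).
Qed.

Lemma cell_rel_sub_equiv : sub_equiv_rel a cell_rel.
Proof.
split.
- exact: measurable_cell_rel.
- move=> [y z] [/= ->|[k [v [x [[_ _ /= <- _] _ [w _ <-]]]]]]; first by exists 1%g; rewrite a1.
  by exists (w * v^-1)%g; rewrite /= aM (act_invK a_pmp).
- by left.
- move=> y z [/= ->|[k [v [x [h wh [w wv /= <-]]]]]]; first by left.
  have [hw whw] := whole_tile h wh wv.
  right; exists k, w, x; split=> //; exists v; first by rewrite (cellP.2 _ _ wv) cellP.1.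
  by case: h.
- move=> y z u [/= ->//|[k [v [x [h wh [w wv /= <-]]]]]] [/= <-|]; first by right;
    exists k, v, x; split=> //; exists w.
  have [hw whw] := whole_tile h wh wv.
  move=> [k' [v' [x' [/= h' wh' [w' wv' <-]]]]].
  have [kk vv xx] := tile_inj hw h'; right; exists k, v, x; split=> //.
  by exists w'; rewrite ?xx // -(cellP.2 _ _ wv) vv.
Qed.

Lemma cell_rel_size : class_size_le cell_rel n.
Proof.
move=> y; have [[k [v [x [h wh]]]]|nh] := pselect (exists k v x, tile k v x y /\ whole k v x).
  apply: (@card_le_fset _ _ (cell v) (fun w => a w x)) => // z; rewrite /xsection /= inE.
  move=> [/= <-|[k' [v' [x' [/= h' wh' [w wv <-]]]]]]; first by exists v; [exact: cellP.1|case: h].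
  by have [_ -> ->] := tile_inj h h'; exists w.
apply: (@card_le_fset _ _ [fset 1%g]%fset (fun w => a w y)); first by rewrite cardfs1.
move=> z; rewrite /xsection /= inE => -[/= <-|[k [v [x [h wh _]]]]].
  by exists 1%g; rewrite /= ?inE.
by case: nh; exists k, v, x.
Qed.

Variables (S D : {fset G}) (r : R).
Hypotheses (D_sym : symmetric_fset D)
  (cellD : forall g h, h \in cell g -> (h * g^-1)%g \in D)
  (r0 : 0 <= r) (cell_r : forall g, boundary_ratio S (cell g) <= r).

Let L := leftover a V B t.
Let E := edge a V B t D.
Let Q : set X := [set y | exists k v x, [/\ tile k v x y, whole k v x & v \in boundary S (cell v)]].

(** In a tile, either the cell of the point is whole and its position lies on the boundary of that
    cell, or some [w] of the cell is missing; then the jump [w v^-1] belongs to [D] and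
    [edge_neighbor] applies. *)
Lemma rel_boundary_sub : rel_boundary S a cell_rel `<=`
  Q `|` (L `|` (E `|` [set y | exists2 d, d \in D & (a d @^-1` E) y])).
Proof.
move=> y [s sS ns]; have [Ly|Ly] := pselect (L y); first by right; left.
have [k [v [x h]]] := tile_at_ex Ly.
have [wh|/fsubsetPn[w wv wP]] := boolP (whole k v x).
  left; exists k, v, x; split=> //; apply/boundaryP; split; first exact: cellP.1.
  exists s => //; apply/negP => sv; apply: ns; rewrite /xsection /= inE; right.
  by exists k, v, x; split=> //; exists (s * v)%g => //; case: h => _ _ <- _; rewrite aM.
right; right; have ayE : a (w * v^-1)%g y = a w x.
  by case: h => _ _ <- _; rewrite aM (act_invK a_pmp).
have nh : ~ ((w * v^-1 * v)%g \in V /\ rest a V B t k (a (w * v^-1)%g y)).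
  by rewrite mulgVK ayE => h'; move/negP: wP; apply; apply/patternP.
have [|] := edge_neighbor aM a1 D_sym h (cellD wv) nh; first by left.
by right; exists (w * v^-1)%g => //; exact: cellD.
Qed.

Lemma measurable_tile k v : measurable [set y | exists x, tile k v x y].
Proof.
have [vV|vV] := boolP (v \in V); last first.
  rewrite (_ : [set _ | _] = set0) //; apply/seteqP; split=> // y [x [_ vV']].
  by rewrite vV' in vV.
have mY k' : measurable (Y k') by exact: (measurable_rest a_pmp).
rewrite (_ : [set _ | _] = Y k `&` a (v^-1)%g @^-1` C k).
  by apply: measurableI => //; apply: (measurable_act a_pmp); exact: (measurable_base a_pmp).
apply/seteqP; split=> y /=.
  by move=> [x [Cx _ <- yk]]; rewrite (act_invK a_pmp).
by move=> [yk Cx]; exists (a (v^-1)%g y); split; rewrite ?(act_Kinv a_pmp).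
Qed.

Lemma measurable_edge : measurable E.
Proof.
rewrite (_ : E = \bigcup_k [set y | exists2 v, v \in boundary D V & [set y | exists x,
    tile k v x y] y]).
  by apply: bigcupT_measurable => k; apply: measurable_fset_has => v; exact: measurable_tile.
apply/seteqP; split=> y; first by move=> [k [v [x [h vD]]]]; exists k => //; exists v => //;
    exists x.
by move=> [k _ [v vD [x h]]]; exists k, v, x.
Qed.

Lemma measurable_inner_boundary : measurable Q.
Proof.
rewrite (_ : Q = \bigcup_k [set y | exists2 v,
    v \in [fset v in V | v \in boundary S (cell v)]%fset &
    [set y | exists x, tile k v x y /\ whole k v x] y]).
  by apply: bigcupT_measurable => k; apply: measurable_fset_has => v; exact: measurable_whole.
apply/seteqP; split=> y.
  move=> [k [v [x [h wh vD]]]]; exists k => //; exists v; last by exists x.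
  by rewrite in_fset_filter vD andbT; case: h.
by move=> [k _ [v]]; rewrite in_fset_filter => /andP[_ vD] [x [h wh]]; exists k, v, x.
Qed.

(** Inside one tile the whole cells form a union of cells [U], and boundary positions make up at
    most a proportion [r] of each of them. *)
Lemma fine_mu_inner_boundary : m Q <= r.
Proof.
have -> : Q = Q `\` L.
  by apply/seteqP; split=> y [] // k [v [x [h wh vb]]]; split;
      [exists k, v, x|exact: leftover_tile_at h].
rewrite -[leLHS]mul1r; apply: (fine_mu_tiles a_pmp mB B_sep) => //;
    first exact: measurable_inner_boundary.
move=> k x Cx; set A := pattern _ _ (Y k) x.
pose U := [fset v in A | (cell v `<=` A)%fset]%fset.
have UA : (#|` U| <= #|` A|)%N by apply: fsubset_card => v; rewrite in_fset_filter => /andP[].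
apply: (@le_trans _ _ (r * #|` U|%:R)); last by rewrite ler_wpM2l // ler_nat.
apply: (@le_trans _ _ (1 * #|` [fset v in U | v \in boundary S (cell v)]%fset|%:R)).
  rewrite !mul1r ler_nat; apply: fsubset_card => v /patternP[vV [[k' [v' [x' [h' wh' vb']]]] yk]].
  have h : tile k v x (a v x) by split.
  have [kk vv xx] := tile_inj h h'; rewrite in_fset_filter vv vb' andbT in_fset_filter -vv.
  by rewrite (mem_pattern h) /A /Y kk xx vv.
rewrite -[X in _ <= _ * (size (enum_fset X))%:R]fset_filterT.
apply: (saturated_count cellP) => g; rewrite in_fset_filter => /andP[gA gsub].
  apply/fsubsetP => h hg; rewrite in_fset_filter (fsubsetP gsub) //=.
  by rewrite (cellP.2 _ _ hg).
have -> : [fset h in cell g | h \in boundary S (cell h)]%fset = boundary S (cell g).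
  apply/fsetP => h; rewrite in_fset_filter; apply/andP/idP => [[hg]|hb].
    by rewrite (cellP.2 _ _ hg).
  have hg : h \in cell g by case/boundaryP: hb.
  by rewrite (cellP.2 _ _ hg).
rewrite fset_filterT mul1r -ler_pdivrMr; first exact: cell_r.
by rewrite ltr0n cardfs_gt0; apply/fset0Pn; exists g; exact: cellP.1.
Qed.

Lemma fine_mu_edge (p : nat) : (p * #|` boundary D V| <= t)%N -> p%:R * m E <= 1.
Proof.
move=> pt; have -> : E = E `\` L.
  by apply/seteqP; split=> y [] // k [v [x [h vb]]]; split;
      [exists k, v, x|exact: leftover_tile_at h].
apply: (fine_mu_tiles a_pmp mB B_sep) => //; first exact: measurable_edge.
move=> k x Cx; rewrite mul1r -natrM ler_nat.
apply: leq_trans (_ : t <= _)%N; last by case: Cx.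
apply: leq_trans pt; rewrite leq_mul2l; apply/orP; right; apply: fsubset_card => v.
move=> /patternP[vV [[k' [v' [x' [h' vb']]]] yk]].
have h : tile k v x (a v x) by split.
by have [_ -> _] := tile_inj h h'.
Qed.

(** The three terms come from the boundaries of whole cells, the leftover, and the edge with its
    [#|D|] translates. *)
Lemma fine_mu_rel_boundary (N : set X) (p q : nat) : (0 < p)%N -> (0 < q)%N -> (0 < t)%N ->
  V != fset0 -> mu.-negligible N -> (forall x, ~ N x -> exists k, B k x) ->
  (p * #|` boundary D V| <= t)%N -> (q * t.-1 <= #|` V|)%N ->
  m (rel_boundary S a cell_rel) <= r + q%:R^-1 + (#|` D|).+1%:R / p%:R.
Proof.
move=> p0 q0 t0 V0 N0 NB pt qt.
have mE := measurable_edge; have mQ := measurable_inner_boundary.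
have mL : measurable L by exact: (measurable_leftover a_pmp).
pose F := [set y | exists2 d, d \in D & (a d @^-1` E) y].
have maE g : measurable (a g @^-1` E) by exact: (measurable_act a_pmp).
have mF : measurable F by exact: measurable_fset_has.
have mU A A' : measurable A -> measurable A' -> m (A `|` A') <= m A + m A'.
  move=> mA mA'; rewrite -fineD ?fin_num_measure //.
  rewrite fine_le ?fin_num_measure //; first exact: measurableU.
    by rewrite fin_numD !fin_num_measure.
  exact: measureU2.
have FE : m F <= #|` D|%:R * m E.
  apply: (@le_trans _ _ (\sum_(g <- D) m (a g @^-1` E))).
    apply: fine_mu_cover => // y [g gD gE]; apply/hasP; exists g => //; exact/asboolP.
  under eq_bigr do rewrite (fine_mu_act a_pmp) //.
  by rewrite big_const_seq count_predT iter_addr_0 mulr_natl.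
have p_gt0 : 0 < p%:R :> R by rewrite ltr0n.
have mEp : m E <= p%:R^-1 by rewrite -[leRHS]mul1r ler_pdivlMr // mulrC fine_mu_edge.
have mLq : m L <= q%:R^-1.
  have V_gt0 : 0 < #|` V|%:R :> R by rewrite ltr0n cardfs_gt0.
  have := fine_mu_leftover a_pmp V mB N0 t0 NB; rewrite -/L -ler_pdivlMl // => /le_trans; apply.
  by rewrite ler_pdivrMl // ler_pdivlMr ?ltr0n // -natrM ler_nat mulnC.
have mLEF : measurable (L `|` (E `|` F)) by do 2 apply: measurableU => //.
apply: (@le_trans _ _ (m (Q `|` (L `|` (E `|` F))))).
  apply: fine_mu_le; [|exact: measurableU|exact: rel_boundary_sub].
  by apply: measurable_rel_boundary; exact: measurable_cell_rel.
apply: le_trans (mU _ _ mQ mLEF) _; rewrite -addrA lerD ?fine_mu_inner_boundary //.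
apply: le_trans (mU _ _ mL (measurableU _ _ mE mF)) _; rewrite lerD //.
apply: le_trans (mU _ _ mE mF) _; rewrite -add1n natrD mulrDl mul1r lerD //.
by apply: le_trans FE _; rewrite ler_wpM2l.
Qed.

End Relation.

(** * Upper bound for the profile of the action *)

Section Profiles.
Context {R : realType} {G : groupType} {d : measure_display} {X : measurableType d}
  (mu : probability X R) (a : G -> X -> X) (S : {fset G}).
Hypotheses (a_pmp : pmp_action mu a) (a_free : free_action mu a)
  (X_borel : standard_borel R X).
Local Notation m A := (fine (mu A)).

Lemma action_profile_lbound n : has_lbound [set m (rel_boundary S a theta) | theta in
  [set theta | sub_equiv_rel a theta /\ class_size_le theta n]].
Proof. by exists 0 => _ [theta _ <-]; exact: fine_mu_ge0. Qed.

Lemma group_profile_le n F : (1 <= #|` F| <= n)%N ->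
  group_profile R S n <= boundary_ratio S F.
Proof.
move=> Fn; apply: ge_inf; last by exists F.
by exists 0 => _ [F' _ <-]; exact: boundary_ratio_ge0.
Qed.

Lemma action_profile_le_multi_tile n N (T : 'I_N -> {fset G}) : amenable_group R G -> (0 < n)%N ->
  multi_tile T -> (forall i, (#|` T i| <= n)%N) ->
  action_profile S mu a n <= max_ratio R S T.
Proof.
move=> G_amen n0 tileT Tn; apply/ler_addgt0Pr => e e0.
have [cell cellP cellE] := cells_of_multi_tile tileT.
pose q := (Num.truncn (2 / e)).+1.
have qe : q%:R^-1 + q%:R^-1 <= e :> R.
  rewrite -mulr2n -[leLHS]mulr_natl ler_pdivrMr ?ltr0n // mulrC -ler_pdivrMr //.
  exact/ltW/truncnS_gt.
pose D := (\bigcup_(i <- enum 'I_N) fmul (T i) (finv (T i)))%fset.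
have DP g : g \in D <-> exists i, g \in fmul (T i) (finv (T i)).
  split=> [/bigfcupP[i _ gi]|[i gi]]; first by exists i.
  by apply/bigfcupP; exists i; rewrite // mem_enum.
have D_sym : symmetric_fset D.
  move=> g /DP[i /fmulP[x [y [xT yT ->]]]]; apply/DP; exists i.
  by rewrite invgM mem_fmul ?mem_finv // -finvE.
have cellD g h : h \in cell g -> (h * g^-1)%g \in D.
  move=> hg; have [i [c gE]] := cellE g; apply/DP; exists i.
  move: hg (cellP.1 g); rewrite gE !mem_rmul => hT gT.
  rewrite (_ : (h * g^-1)%g = ((h * c^-1) * (g * c^-1)^-1)%g) ?mem_fmul ?mem_finv //.
  by rewrite invgM invgK mulgA mulgVK.
(* With this [p] the edge error is [1 / q], equal to the leftover error, and [q] makes their sum at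
   most [e]. *)
pose p := (q * (#|` D|).+1)%N.
have [V V0 Vp] := folner_boundary G_amen D (q * p)%N.
pose t := (#|` V| %/ q).+1.
have [B [X0 [mB X00 XB B_sep]]] := free_cover a_pmp a_free X_borel V.
have [U mU sepU] := separating_sets X_borel.
have mdiag := measurable_diagonal mU sepU.
have cell_le g : (#|` cell g| <= n)%N.
  by have [i [c ->]] := cellE g; rewrite card_rmul.
have cell_r g : boundary_ratio S (cell g) <= max_ratio R S T.
  by have [i [c ->]] := cellE g; rewrite boundary_ratio_rmul; exact: le_max_ratio.
pose theta := cell_rel a V B t cell.
apply: (@le_trans _ _ (m (rel_boundary S a theta))).
  apply: ge_inf; first exact: action_profile_lbound.
  have th1 : sub_equiv_rel a theta := cell_rel_sub_equiv a_pmp mdiag t mB B_sep cellP.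
  have th2 : class_size_le theta n := cell_rel_size a_pmp t B_sep n0 cellP cell_le.
  by exists theta.
have p0 : (0 < p)%N by rewrite muln_gt0.
have pt : (p * #|` boundary D V| <= t)%N.
  rewrite -ltnS; apply: ltnW; rewrite ltnS /t.
  have : (p * #|` boundary D V| <= #|` V| %/ q)%N by rewrite leq_divRL // mulnC mulnA.
  by move/leq_trans; apply.
have qt : (q * t.-1 <= #|` V|)%N by rewrite mulnC leq_divM.
have := fine_mu_rel_boundary a_pmp mdiag mB B_sep cellP D_sym cellD (max_ratio_ge0 R S T) cell_r
  p0 (ltn0Sn _) (ltn0Sn _) V0 X00 XB pt qt.
move=> /le_trans; apply; rewrite -addrA lerD2l; apply: le_trans qe; rewrite lerD2l.
by rewrite /p natrM invfM mulrCA divff ?mulr1 // pnatr_eq0.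
Qed.

End Profiles.

(** * Mass transport along the classes *)

Section LowerBound.
Context {R : realType} {G : groupType} {d : measure_display} {X : measurableType d}
  (mu : probability X R) (a : G -> X -> X) (S : {fset G}).
Hypotheses (a_pmp : pmp_action mu a) (a_free : free_action mu a).
Variables (e : nat -> G) (theta : set (X * X)) (n : nat).
Hypotheses (e_onto : forall g, exists k, e k = g)
  (th : sub_equiv_rel a theta) (th_size : class_size_le theta n).
Local Notation m A := (fine (mu A)).

Let a1 x : a 1%g x = x. Proof. by case: a_pmp. Qed.
Let aM g h x : a (g * h)%g x = a g (a h x). Proof. by case: a_pmp. Qed.
Let th_refl x : theta (x, x). Proof. by case: th. Qed.
Let th_sym x y : theta (x, y) -> theta (y, x). Proof. by case: th => _ _ _ h _; exact: h. Qed.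
Let th_trans x y z : theta (x, y) -> theta (y, z) -> theta (x, z).
Proof. by case: th => _ _ _ _ h; exact: h. Qed.

Let step g : set X := [set x | theta (x, a g x)].
(** The class of [x] seen in [G]. Moving [x] by [g] translates this set on the right by [g^-1],
    which keeps its size and its boundary ratio. *)
Let class_fset x (F : {fset G}) := forall g, step g x <-> g \in F.
Let level j : set X := [set x | exists2 F, class_fset x F & #|` F| = j].
Let stage i : {fset G} := [fset e k | k in iota 0 i]%fset.
(** Only group elements enumerated before [i] may occur, so mass transport inside a class is a
    finite sum; the limit in [i] comes afterwards. *)
Let level_in i j : set X :=
  [set x | exists2 F, class_fset x F & #|` F| = j /\ (F `<=` stage i)%fset].
Let bdry : set X := rel_boundary S a theta.

Let mstep g : measurable (step g).
Proof.
rewrite -[X in measurable X]setTI; apply: (measurable_fun_pair _ _ measurableT) => //.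
  by case: a_pmp => _ _ am _; exact: am.
by case: th.
Qed.

Let class_fset_uniq x F F' : class_fset x F -> class_fset x F' -> F = F'.
Proof. by move=> h h'; apply/fsetP => g; apply/idP/idP => [/(h g).2/(h' g).1|/(h' g).2/(h g).1].
    Qed.

Let class_fset_act x F g : class_fset x F -> step g x ->
  class_fset (a g x) [fset (h * g^-1)%g | h in F]%fset.
Proof.
move=> xF gx h; rewrite mem_rmul invgK; split=> [hgx|/xF].
  by apply/xF; rewrite /step /= aM; exact: th_trans gx hgx.
by rewrite /step /= aM; apply: th_trans; exact: th_sym.
Qed.

Lemma class_fset_free x : (forall g, a g x = x -> g = 1%g) ->
  exists2 F, class_fset x F & (0 < #|` F| <= n)%N.
Proof.
move=> x_free; have a_inj : injective (a^~ x).
  move=> g h /= gh; apply/eqP; rewrite -(inj_eq (mulgI h^-1)%g) mulVg; apply/eqP/x_free.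
  by rewrite aM gh -aM mulVg a1.
pose A : set G := [set g | step g x].
have An : (A #<= `I_n)%card.
  apply: card_le_trans (th_size x); rewrite -(card_le_eql (inj_card_eq (A := A) (in2W a_inj))).
  by apply: subset_card_le => _ [g gA <-]; rewrite /xsection /= inE.
have Afin : finite_set A by exact: card_le_finite An (finite_II n).
exists (fset_set A); first by move=> g; rewrite in_fset_set // inE.
apply/andP; split; last by rewrite geq_card_fset_set.
by rewrite cardfs_gt0; apply/fset0Pn; exists 1%g; rewrite in_fset_set // inE /A /step /= a1.
Qed.

Let level_inE i j : level_in i j = [set x | forall k, theta (x, a (e k) x) -> e k \in stage i] `&`
  [set x | #|` [fset g in stage i | `[< step g x >]]%fset| = j].
Proof.
apply/seteqP; split=> x.
  move=> [F xF [Fj /fsubsetP Fi]]; split; first by move=> k /xF/Fi.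
  rewrite /= -Fj; congr (size (enum_fset _)); apply/fsetP => g; rewrite in_fset_filter.
  apply/andP/idP => [[_ /asboolP/xF]//|gF]; split; [exact: Fi|exact/asboolP/xF].
move=> [xi xj]; exists [fset g in stage i | `[< step g x >]]%fset.
  move=> g; rewrite in_fset_filter; split=> [gx|/andP[_ /asboolP]//].
  by have [k kg] := e_onto g; rewrite -{1}kg xi ?kg //=; exact/asboolP.
by split=> //; apply/fsubsetP => g; rewrite in_fset_filter => /andP[].
Qed.

Let mlevel_in i j : measurable (level_in i j).
Proof.
rewrite level_inE; apply: measurableI.
  rewrite (_ : [set _ | _] = \bigcap_k [set x | theta (x, a (e k) x) -> e k \in stage i]).
    apply: bigcapT_measurable => k; case: (e k \in stage i).
      by rewrite (_ : [set _ | _] = setT) //; apply/seteqP; split.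
    rewrite (_ : [set _ | _] = ~` step (e k)); first exact: measurableC.
    by apply/seteqP; split=> x //= nx /nx.
  by apply/seteqP; split=> x /= xk k; [move=> _|]; exact: xk.
rewrite (_ : [set _ | _] = [set x | exists2 P,
    P \in [fset P in fpowerset (stage i) | #|` P| == j]%fset &
    forall g, g \in stage i -> (if g \in P then step g else ~` step g) x]).
  apply: measurable_fset_has => P; apply: measurable_fset_all => g.
  by case: ifP => // _; exact: measurableC.
apply/seteqP; split=> x /=.
  move=> xj; exists [fset g in stage i | `[< step g x >]]%fset.
    rewrite in_fset_filter fpowersetE xj eqxx andbT.
    by apply/fsubsetP => g; rewrite in_fset_filter => /andP[].
  by move=> g gi; rewrite in_fset_filter gi /=; case: asboolP.
move=> [P]; rewrite in_fset_filter fpowersetE => /andP[/fsubsetP Pi /eqP <-] h.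
congr (size (enum_fset _)); apply/fsetP => g; rewrite in_fset_filter.
apply/andP/idP => [[gi /asboolP gx]|gP]; first by have := h g gi; case: ifP.
by split; [exact: Pi|apply/asboolP; have := h g (Pi _ gP); rewrite gP].
Qed.

Let stageS i k : (i <= k)%N -> (stage i `<=` stage k)%fset.
Proof.
move=> ik; apply/fsubsetP => _ /imfsetP[l /= li ->]; apply/imfsetP; exists l => //=.
by move: li; rewrite !mem_iota /= !add0n => /leq_trans; apply.
Qed.

Let levelE j : level j = \bigcup_i level_in i j.
Proof.
apply/seteqP; split=> x; last by move=> [i _ [F xF [Fj _]]]; exists F.
move=> [F xF Fj].
suff [i Fi] : exists i, (F `<=` stage i)%fset by exists i => //; exists F.
have /choice[c cP] := e_onto.
exists (\max_(g <- F) (c g)).+1; apply/fsubsetP => g gF; apply/imfsetP; exists (c g);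
    last by rewrite cP.
by rewrite [_ \in _]mem_iota add0n ltnS; exact: leq_bigmax_seq.
Qed.

Let mlevel j : measurable (level j).
Proof. by rewrite levelE; apply: bigcupT_measurable. Qed.

Let mbdry : measurable bdry.
Proof. by apply: (measurable_rel_boundary a_pmp); case: th. Qed.

(* Each point of the boundary sends mass [1] to all [j] points of its class; a
   point with class [F] then receives [#|boundary S F| >= r * j]. *)
Lemma level_transport i j r : (0 < j)%N -> 0 <= r ->
  (forall F, #|` F| = j -> r <= boundary_ratio S F) ->
  r * m (level_in i j) <= m (bdry `&` level j).
Proof.
move=> j0 r0 rF; have j_gt0 : 0 < j%:R :> R by rewrite ltr0n.
pose A g := bdry `&` level j `&` step (g^-1)%g.
have mA g : measurable (A g) by apply: measurableI => //; exact: measurableI.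
have maA g : measurable (a g @^-1` A g) by exact: (measurable_act a_pmp).
have mbl : measurable (bdry `&` level j) by exact: measurableI.
have lower : (j%:R * r) * \sum_(k <- [:: tt]) m (level_in i j) <=
    1 * \sum_(g <- stage i) m (a g @^-1` A g).
  apply: indic_sum_le => //; first by rewrite mulr_ge0.
  apply: aeW => y; rewrite big_seq1 mul1r sum_indic_card indicE.
  case: (boolP (y \in _)) => [|_]; last by rewrite mulr0.
  rewrite inE => -[F yF [Fj Fi]]; rewrite mulr1 mulrC -ler_pdivlMr //.
  apply: le_trans (rF F Fj) _; rewrite /boundary_ratio Fj ler_pM2r ?invr_gt0 // ler_nat.
  apply: fsubset_card => g /boundaryP[gF [s sS sg]]; have gy : step g y by exact/yF.
  rewrite in_fset_filter (fsubsetP Fi) //=; apply/asboolP; split; last first.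
    by rewrite /step /= -aM mulVg a1; exact: th_sym.
  split; last by exists [fset (h * g^-1)%g | h in F]%fset;
      [exact: class_fset_act|rewrite card_rmul].
  exists s => //; rewrite /xsection /= inE -aM => sgy; move/negP: sg; apply.
  by apply/yF; exact: th_trans gy sgy.
have upper : 1 * \sum_(g <- stage i) m (A g) <= j%:R * \sum_(k <- [:: tt]) m (bdry `&` level j).
  apply: indic_sum_le => //; apply: aeW => z; rewrite big_seq1 mul1r sum_indic_card indicE.
  case: (boolP (z \in _)) => [|nz].
    rewrite inE => -[_ [F zF Fj]]; rewrite mulr1 ler_nat -Fj.
    apply: (@leq_card_inj _ _ (fun g => g^-1)%g) => [u v _ _ /invg_inj //|g].
    by rewrite in_fset_filter => /andP[_ /asboolP[_ /zF]].
  rewrite (_ : [fset _ in _ | _]%fset = fset0) ?cardfs0 ?mulr0 //.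
  apply/fsetP => g; rewrite in_fset_filter in_fset0; apply/negP => /andP[_ /asboolP[zb _]].
  by move/negP: nz; apply; rewrite inE.
move: lower; under eq_bigr do rewrite ?big_seq1.
under [X in _ <= 1 * X]eq_bigr do rewrite (fine_mu_act a_pmp) //.
move=> /le_trans/(_ upper); rewrite !big_seq1 -mulrA ler_pM2l //.
Qed.

(** Almost every point has a class of one definite size between 1 and [n]: the levels cover almost
    everything, their traces on the boundary are disjoint, and the transport inequalities add up. *)
Lemma rel_boundary_ge r : 0 <= r ->
  (forall F, (0 < #|` F| <= n)%N -> r <= boundary_ratio S F) -> r <= m bdry.
Proof.
rewrite le_eqVlt => /predU1P[<- _|r0 rF]; first exact: fine_mu_ge0.
have level_le j : (0 < j <= n)%N -> r * m (level j) <= m (bdry `&` level j).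
  move=> /andP[j0 jn]; rewrite mulrC -ler_pdivlMr // levelE.
  apply: fine_mu_bigcup_le => // [i k ik x [F xF [Fj Fi]]|i].
    by exists F => //; split=> //; exact: fsubset_trans Fi (stageS ik).
  rewrite -levelE ler_pdivlMr // mulrC; apply: level_transport => // [|F Fj]; first exact: ltW.
  by apply: rF; rewrite Fj j0.
pose s := [fset j in iota 1 n]%fset.
have sE j : (j \in s) = (0 < j <= n)%N by rewrite in_fset mem_iota add1n ltnS.
have ub : 1 * \sum_(j <- s) m (bdry `&` level j) <= 1 * \sum_(k <- [:: tt]) m bdry.
  apply: indic_sum_le => // [j|]; first exact: measurableI.
  apply: aeW => x; rewrite big_seq1 !mul1r sum_indic_card indicE.
  case: (boolP (x \in bdry)) => [xb|nb]; last first.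
    rewrite (_ : [fset _ in _ | _]%fset = fset0) ?cardfs0 //.
    apply/fsetP => j; rewrite in_fset_filter in_fset0; apply/negP => /andP[_ /asboolP[xb _]].
    by move/negP: nb; apply; rewrite inE.
  have [[F xF]|nF] := pselect (exists F, class_fset x F).
    rewrite lern1 -(cardfs1 #|` F|); apply: fsubset_card => j.
    rewrite in_fset_filter inE => /andP[_ /asboolP[_ [F' xF' <-]]].
    by rewrite (class_fset_uniq xF xF').
  rewrite (_ : [fset _ in _ | _]%fset = fset0) ?cardfs0 //.
  apply/fsetP => j; rewrite in_fset_filter in_fset0; apply/negP => /andP[_ /asboolP[_ [F xF _]]].
  by apply: nF; exists F.
have lb : 1 * \sum_(k <- [:: tt]) m [set: X] <= 1 * \sum_(j <- s) m (level j).
  apply: indic_sum_le => //; apply: filterS a_free => x x_free.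
  rewrite big_seq1 !mul1r sum_indic_card indicT ler1n cardfs_gt0; apply/fset0Pn.
  have [F xF Fn] := class_fset_free x_free; exists #|` F|.
  by rewrite in_fset_filter sE Fn; apply/asboolP; exists F.
move: lb ub; rewrite !big_seq1 !mul1r probability_setT => lb; apply: le_trans.
rewrite -[r]mulr1; apply: le_trans (ler_wpM2l (ltW r0) lb) _.
rewrite mulr_sumr big_seq [leRHS]big_seq; apply: ler_sum => j.
by rewrite sE => /level_le.
Qed.

End LowerBound.

(** * Comparison of the profiles *)

Lemma group_profile_ge0 (R : realType) (G : groupType) (S : {fset G}) n : (0 < n)%N ->
  0 <= group_profile R S n.
Proof.
move=> n0; apply: lb_le_inf; last by move=> _ [F _ <-]; exact: boundary_ratio_ge0.
by exists (boundary_ratio S [fset 1%g]%fset); exists [fset 1%g]%fset; rewrite //= cardfs1.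
Qed.

(** Shows that the infimum defining the profile of the action runs over a nonempty set. *)
Lemma diagonal_sub_equiv (R : realType) (G : groupType) d (X : measurableType d)
    (mu : probability X R) (a : G -> X -> X) n :
  standard_borel R X -> pmp_action mu a -> (0 < n)%N ->
  sub_equiv_rel a [set xy | xy.1 = xy.2] /\ class_size_le [set xy : X * X | xy.1 = xy.2] n.
Proof.
move=> /separating_sets[U mU sepU] [a1 _ _ _] n0; split.
  split=> //=; first exact: measurable_diagonal mU sepU.
    by move=> [x y] /= ->; exists 1%g.
  by move=> x y z ->.
move=> x; apply: (@card_le_fset _ _ [fset 0%N]%fset (fun=> x)); first by rewrite cardfs1.
by move=> y; rewrite /xsection /= inE => /= <-; exists 0%N; rewrite //= inE.
Qed.

Lemma group_profile_le_action_profile (R : realType) (G : groupType) (S : {fset G})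
    d (X : measurableType d) (mu : probability X R) (a : G -> X -> X) n :
  symmetric_fset S -> generates S -> standard_borel R X -> pmp_action mu a ->
  free_action mu a -> (0 < n)%N ->
  group_profile R S n <= action_profile S mu a n.
Proof.
move=> S_sym S_gen X_borel a_pmp a_free n0; have [e e_onto] := group_enum S_sym S_gen.
apply: lb_le_inf.
  have [th th_size] := diagonal_sub_equiv X_borel a_pmp n0.
  by eexists; exists [set xy | xy.1 = xy.2].
move=> _ [theta [th th_size] <-].
apply: (rel_boundary_ge a_pmp a_free e_onto th th_size); first exact: group_profile_ge0.
by move=> F Fn; exact: group_profile_le.
Qed.

(** Where [f n = 0] the quotient [c n / f n] is 0 by convention, so convergence to 1 forces
    [f n > 0] eventually, and the inequalities may be divided by [f n]. *)
Lemma asymptotic_squeeze (R : realType) (b c f : nat -> R) :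
  (forall n, (0 < n)%N -> 0 <= f n) ->
  (forall n, (0 < n)%N -> f n <= b n) -> (forall n, (0 < n)%N -> b n <= c n) ->
  asymptotic c f -> asymptotic b f.
Proof.
move=> f0 fb bc cf.
have f_gt0 : \forall n \near \oo, 0 < f n.
  have c_gt0 : \forall n \near \oo, 0 < c n / f n by exact: cvgr_gt cf _ ltr01.
  near=> n; have n0 : (0 < n)%N by near: n; exists 1%N.
  rewrite lt0r f0 // andbT; apply/eqP => fn0.
  by have : 0 < c n / f n; [near: n|rewrite fn0 invr0 mulr0 ltxx].
apply: (@squeeze_cvgr _ _ _ _ (fun=> 1) (fun n => c n / f n)); [|exact: cvg_cst|exact: cf].
near=> n.
have n0 : (0 < n)%N by near: n; exists 1%N.
have fn0 : 0 < f n by near: n.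
by rewrite ler_pdivlMr // mul1r fb //= ler_pM2r ?invr_gt0 // bc.
Unshelve. all: by end_near. Qed.

Theorem theorem1p4 (R : realType) (G : groupType) (S : {fset G})
  (S_sym : symmetric_fset S) (S_gen : generates S)
  (G_inf : infinite_set [set: G]) (G_amen : amenable_group R G) :
  (exists (N : nat -> nat) (T : forall n, 'I_(N n) -> {fset G}),
     folner_multi_tiles R S N T) /\
  (forall (N : nat -> nat) (T : forall n, 'I_(N n) -> {fset G}),
     folner_multi_tiles R S N T ->
     forall (d : measure_display) (X : measurableType d)
       (mu : probability X R) (a : G -> X -> X),
       standard_borel R X -> pmp_action mu a -> free_action mu a ->
       (forall n, (0 < n)%N -> action_profile S mu a n <= max_ratio R S (T n)) /\
       (asymptotic (fun n => max_ratio R S (T n)) (group_profile R S) ->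
        asymptotic (action_profile S mu a) (group_profile R S))).
Proof.
split; first exact: folner_multi_tiles_exist.
move=> N T [tileT _] d X mu a X_borel a_pmp a_free.
have upper n : (0 < n)%N -> action_profile S mu a n <= max_ratio R S (T n).
  by move=> n0; have [] := tileT n n0; exact: action_profile_le_multi_tile.
split=> //; apply: asymptotic_squeeze => // n n0; first exact: group_profile_ge0.
exact: group_profile_le_action_profile.
Qed.
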